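(* Let $R=\mathbb{C}[x,y,z]$ and let $I\subset R$ be an ideal of height $2$ that is locally a complete intersection and is minimally generated by three homogeneous polynomials of the same degree. Then $R/I$ is arithmetically Cohen-Macaulay if and only if there exists a regular syzygy on $I$.
   Context: $R=\mathbb{C}[x,y,z]$ has the standard grading. $I$ is locally a complete intersection if for every minimal prime ideal $\mathfrak{p}$ of $I$ the localization $I_{\mathfrak{p}}\subset R_{\mathfrak{p}}$ can be generated by two elements. $R/I$ is arithmetically Cohen-Macaulay if $R/I$ is a Cohen-Macaulay ring; for $I$ as in the claim this is equivalent to $R/I$ having a minimal free resolution of the form $0\to R^2\to R^3\to R\to R/I\to 0$. A (first) syzygy on $I$ is a triple $(A,B,C)$ of homogeneous polynomials in $R$ such that $Af_1+Bf_2+Cf_3=0$ for some minimal generating set $\{f_1,f_2,f_3\}$ of $I$ consisting of homogeneous polynomials. A syzygy $(A,B,C)$ is called regular if $A,B,C$ form an $R$-regular sequence (for homogeneous $A,B,C$ this means that the ideal $\langle A,B,C\rangle$ has height $3$, equivalently that $A,B,C$ have no common zero in $\mathbb{P}^2$). *)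

(* Defs.v *)
From HB Require Import structures.
From mathcomp Require Import all_boot all_algebra.
From mathcomp Require Import reals.
From mathcomp Require Import complex.
From mathcomp Require Import mpoly.

Set Implicit Arguments.
Unset Strict Implicit.
Unset Printing Implicit Defensive.

Import GRing.Theory.
Local Open Scope ring_scope.

(* Ideals and prime ideals are mathcomp's [idealr A] and [prime_idealr A]
   (both proper), and R/I is [{ideal_quot I}]. *)

Section CommutativeRing.
Variable A : comNzRingType.
Implicit Types (I J : idealr A) (P Q : prime_idealr A) (s : seq A).

Definition in_span s (a : A) : Prop :=
  exists c : 'I_(size s) -> A, a = \sum_(i < size s) c i * s`_i.

Definition generates s I : Prop := forall a, a \in I <-> in_span s a.

(* Minimality is with respect to inclusion; [subseq] ranges over all
   subfamilies of s, so in particular s has no repetitions. *)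
Definition minimally_generates s I : Prop :=
  generates s I /\ forall t, subseq t s -> generates t I -> t = s.

Definition noetherian : Prop := forall I, exists s, generates s I.

Definition maximal_ideal I : Prop :=
  forall J, {subset I <= J} -> {subset J <= I}.

Definition minimal_prime_of I P : Prop :=
  {subset I <= P} /\
  forall Q, {subset I <= Q} -> {subset Q <= P} -> {subset P <= Q}.

Definition prime_chain_to P (n : nat) : Prop :=
  exists c : 'I_n.+1 -> prime_idealr A,
    (forall i j : 'I_n.+1, (i < j)%N ->
       {subset c i <= c j} /\ ~ {subset c j <= c i}) /\
    c ord_max =i P.

Definition prime_height P (n : nat) : Prop :=
  prime_chain_to P n /\ forall m, prime_chain_to P m -> (m <= n)%N.

(* The infimum of the heights of the primes containing I; primes of infinite
   height satisfy no [prime_height P m] and do not affect it. *)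
Definition height I (n : nat) : Prop :=
  (exists P, {subset I <= P} /\ prime_height P n) /\
  forall P m, {subset I <= P} -> prime_height P m -> (n <= m)%N.

Definition regular_sequence s : Prop :=
  ~ in_span s 1 /\
  forall (i : nat) (a : A), (i < size s)%N ->
    in_span (take i s) (s`_i * a) -> in_span (take i s) a.

Definition depth I (n : nat) : Prop :=
  (exists s, [/\ {subset s <= I}, regular_sequence s & size s = n]) /\
  forall s, {subset s <= I} -> regular_sequence s -> (size s <= n)%N.

End CommutativeRing.

(* As in Eisenbud, Commutative Algebra, Section 18.2: depth(M, A) = codim M
   for every maximal ideal M. *)
Definition cohen_macaulay (A : comNzRingType) : Prop :=
  noetherian A /\
  forall M : prime_idealr A, maximal_ideal M ->
    exists n : nat, depth M n /\ prime_height M n.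

Definition arithmetically_cohen_macaulay (A : comNzRingType) (I : idealr A) :
    Prop :=
  cohen_macaulay {ideal_quot I}.

Section Localization.
Variable A : idomainType.
Implicit Types (I : idealr A) (P : prime_idealr A) (x : {fraction A}).
Local Notation "a %:F" := (@FracField.tofrac A a).

(* A being a domain, the localization at P is taken inside its fraction
   field. *)
Definition in_loc_ring P x : Prop :=
  exists a b : A, b \notin P /\ x = a%:F / b%:F.

Definition in_loc_ideal I P x : Prop :=
  exists a b : A, [/\ a \in I, b \notin P & x = a%:F / b%:F].

Definition locally_complete_intersection I : Prop :=
  forall P, minimal_prime_of I P ->
    exists g1 g2 : {fraction A}, forall x,
      in_loc_ideal I P x <->
      exists u v, [/\ in_loc_ring P u, in_loc_ring P v & x = u * g1 + v * g2].

End Localization.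

Section Syzygy.
Variables (n : nat) (F : fieldType).

Definition homogeneous (p : {mpoly F[n]}) : Prop :=
  exists d : nat, p \is d.-homog.

Definition syzygy_on (I : idealr {mpoly F[n]}) (A B C : {mpoly F[n]}) : Prop :=
  [/\ homogeneous A, homogeneous B & homogeneous C] /\
  exists f1 f2 f3 : {mpoly F[n]},
    [/\ homogeneous f1, homogeneous f2, homogeneous f3,
        minimally_generates [:: f1; f2; f3] I
      & A * f1 + B * f2 + C * f3 = 0].

End Syzygy.

(* Main.v *)
Require Import Defs.
From mathcomp Require Import all_boot all_order all_algebra.
From mathcomp Require Import reals.
From mathcomp Require Import complex.
From mathcomp Require Import mpoly.
From mathcomp Require Import boolp ring zify.
From HB Require Import structures.

(** Write [R = F[x,y,z]] and [m = (x,y,z)].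

    For an ideal [I] of height two generated by forms, Cohen-Macaulayness of
    [R/I] is decided at the origin: it holds if and only if some element of
    [m] is a nonzerodivisor modulo [I] ([cohen_macaulay_of_nzd] and
    [nzd_of_cohen_macaulay]).  Indeed any other maximal ideal contains an
    element with nonzero constant term, and such an element is a
    nonzerodivisor modulo every homogeneous ideal, as one sees on lowest
    components; heights in [R/I] are at most one because chains of primes in
    [R] have length at most three ([prime_chain_le]).

    Both implications restrict the generators [f] to a general line of the
    projective plane.  As [I] lies in no prime of height one, a general linear
    form [l] satisfies [m^N <= I + (l)] ([general_linear_form]), so [f] has no
    common zero on the line [l = 0].

    If [(A,B,C)] is a regular syzygy, exactness of the Koszul complex of
    [(A,B,C)] says that [f] is the vector of minors of a matrix with columns
    [(A,B,C)] and a second vector ([koszul_relation]).  On the line the minors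
    have no common factor, hence their syzygies there are generated by the two
    columns, and this means that [l] is a nonzerodivisor modulo [I]
    ([nzd_of_minors]).

    Conversely, if [R/I] is Cohen-Macaulay then [l] is a nonzerodivisor
    modulo [I], so syzygies on the line lift.  Two syzygies [v], [w] which are
    independent on the line and of least possible degrees have [f] as their
    vector of minors: a zero of the quotient of [v x w] by [f] would allow a
    syzygy to be divided by a linear form ([hilbert_burch_matrix]).  Off the
    zeros of [I] the vectors [v] and [w] are independent.  At a minimal prime
    of [I] they do not both vanish, since otherwise three would be the minimal
    number of local generators ([minors_locally_two_generated]).  A general
    combination [w + t l^k v] therefore vanishes nowhere
    ([nowhere_vanishing_syzygy]).  Three forms of the same degree without
    common zero become a regular sequence after an elementary operation, which
    the generators of [I] absorb ([generic_regular]). *)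

Module HilbertBurch.
Import Order.TTheory GRing.Theory.
Local Open Scope ring_scope.
Set Implicit Arguments.
Unset Strict Implicit.
Unset Printing Implicit Defensive.

(** * Ideals, primes and nonzerodivisors *)

Section Ideals.
Variable A : comNzRingType.
Implicit Types (J S : A -> Prop) (s : seq A) (a b g : A) (P Q M : prime_idealr A).

(** Unlike the boolean, proper [idealr], these predicates may hold of the
    whole ring, so that spans and sums of ideals stay among them. *)
Definition is_ideal J : Prop :=
  [/\ J 0, forall a b, J a -> J b -> J (a + b) & forall a b, J b -> J (a * b)].

Lemma is_ideal0 J : is_ideal J -> J 0. Proof. by case. Qed.

Lemma is_idealD J a b : is_ideal J -> J a -> J b -> J (a + b).
Proof. by case=> _ h _; apply: h. Qed.

Lemma is_idealMl J a b : is_ideal J -> J b -> J (a * b).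
Proof. by case=> _ _; apply. Qed.

Lemma is_idealMr J a b : is_ideal J -> J a -> J (a * b).
Proof. by rewrite mulrC; apply: is_idealMl. Qed.

Lemma is_idealN J a : is_ideal J -> J a -> J (- a).
Proof. by move=> hJ; rewrite -mulN1r; apply: is_idealMl. Qed.

Lemma is_idealB J a b : is_ideal J -> J a -> J b -> J (a - b).
Proof. by move=> hJ Ja Jb; apply: is_idealD => //; apply: is_idealN. Qed.

Lemma is_ideal_sum J (I : Type) (r : seq I) (p : pred I) (f : I -> A) :
  is_ideal J -> (forall i, p i -> J (f i)) -> J (\sum_(i <- r | p i) f i).
Proof.
move=> hJ h; elim/big_ind: _ => //; first exact: is_ideal0.
by move=> x y; apply: is_idealD.
Qed.

Lemma is_ideal_mem (I : idealr A) : is_ideal (fun a => a \in I).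
Proof.
split=> [|a b|a b]; [exact: idealr0 | exact: rpredD | exact: idealMr].
Qed.

Lemma is_ideal_prime P : is_ideal (fun a => a \in P).
Proof. exact: is_ideal_mem. Qed.

Lemma prime_notinM P a b : a \notin P -> b \notin P -> a * b \notin P.
Proof. by rewrite prime_idealrM negb_or => -> ->. Qed.

Lemma prime_exp P a n : a ^+ n \in P -> a \in P.
Proof.
elim: n => [|n IH]; first by rewrite expr0 idealr1.
by rewrite exprS prime_idealrM => /orP[].
Qed.

Lemma idealr_of_is_ideal J : is_ideal J -> ~ J 1 ->
  exists I : idealr A, forall a, a \in I <-> J a.
Proof.
move=> hJ J1; pose S := fun a => `[< J a >].
have cl : idealr_closed S.
  split=> [||a u v]; rewrite ?unfold_in; first by apply/asboolP; apply: is_ideal0.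
    by apply/asboolP.
  move=> /asboolP Ju /asboolP Jv; apply/asboolP.
  by apply: is_idealD => //; apply: is_idealMl.
exists (HB.pack_for (idealr A) S (isIdealr.Build A S cl)) => a.
by split=> /asboolP.
Qed.

Lemma prime_of_is_ideal J : is_ideal J -> ~ J 1 ->
  (forall a b, J (a * b) -> J a \/ J b) ->
  exists P, forall a, a \in P <-> J a.
Proof.
move=> hJ J1 Jp; pose S := fun a => `[< J a >].
have cl : idealr_closed S.
  split=> [||a u v]; rewrite ?unfold_in; first by apply/asboolP; apply: is_ideal0.
    by apply/asboolP.
  move=> /asboolP Ju /asboolP Jv; apply/asboolP.
  by apply: is_idealD => //; apply: is_idealMl.
have pr : prime_idealr_closed S.
  by move=> u v /asboolP /Jp [] h; apply/orP; [left|right]; apply/asboolP.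
exists (HB.pack_for (prime_idealr A) S (isIdealr.Build A S cl)
  (isPrimeIdealrClosed.Build A S pr)) => a.
by split=> /asboolP.
Qed.

Lemma is_ideal_span s : is_ideal (in_span s).
Proof.
split.
- by exists (fun=> 0); rewrite big1 // => i _; rewrite mul0r.
- move=> a b [c ->] [c' ->]; exists (fun i => c i + c' i).
  by rewrite -big_split; apply: eq_bigr => i _; rewrite mulrDl.
- move=> a b [c ->]; exists (fun i => a * c i).
  by rewrite mulr_sumr; apply: eq_bigr => i _; rewrite mulrA.
Qed.

Lemma in_span_sub J s a : is_ideal J -> (forall x, x \in s -> J x) ->
  in_span s a -> J a.
Proof.
move=> hJ h [c ->]; apply: is_ideal_sum => // i _.
by apply: is_idealMl => //; apply/h/mem_nth.
Qed.

Lemma in_span0 a : in_span [::] a <-> a = 0.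
Proof.
split=> [[c ->]|->]; last exact: is_ideal0 (is_ideal_span _).
by rewrite big_ord0.
Qed.

Lemma in_span_cons x s a :
  in_span (x :: s) a <-> exists c, in_span s (a - c * x).
Proof.
split=> [[c ->]|[c [c' e]]].
  exists (c ord0); rewrite big_ord_recl /= addrC addKr.
  by exists (fun i => c (lift ord0 i)).
exists (fun i => if unlift ord0 i is Some j then c' j else c).
rewrite big_ord_recl unlift_none /= -[a](subrK (c * x)) e addrC; congr (_ + _).
by apply: eq_bigr => i _; rewrite liftK.
Qed.

Lemma in_span1 x a : in_span [:: x] a <-> exists c, a = c * x.
Proof.
rewrite in_span_cons; split=> [[c /in_span0 /subr0_eq ->]|[c ->]].
  by exists c.
by exists c; apply/in_span0; rewrite subrr.
Qed.

Lemma in_span2 x y a :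
  in_span [:: x; y] a <-> exists c d, a = c * x + d * y.
Proof.
rewrite in_span_cons; split=> [[c /in_span1[d e]]|[c [d ->]]].
  by exists c, d; rewrite -e; ring.
by exists c; apply/in_span1; exists d; ring.
Qed.

Lemma in_span3 x y z a :
  in_span [:: x; y; z] a <-> exists c d e, a = c * x + d * y + e * z.
Proof.
rewrite in_span_cons; split=> [[c /in_span2[d [f e]]]|[c [d [f ->]]]].
  by exists c, d, f; rewrite -addrA -e; ring.
by exists c; apply/in_span2; exists d, f; ring.
Qed.

Lemma mem_in_span s x : x \in s -> in_span s x.
Proof.
elim: s => // y s IH; rewrite inE => /orP[/eqP->|/IH h]; apply/in_span_cons.
  by exists 1; rewrite mul1r subrr; apply: is_ideal0 (is_ideal_span _).
by exists 0; rewrite mul0r subr0.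
Qed.

(** The ideal [J + (g)]. *)
Definition adjoin J g a : Prop := exists c, J (a - c * g).

Lemma is_ideal_adjoin J g : is_ideal J -> is_ideal (adjoin J g).
Proof.
move=> hJ; split.
- by exists 0; rewrite mul0r subr0; apply: is_ideal0.
- move=> a b [c h] [c' h']; exists (c + c').
  by rewrite (_ : _ - _ = (a - c * g) + (b - c' * g)); [apply: is_idealD|ring].
- move=> a b [c h]; exists (a * c).
  by rewrite (_ : _ - _ = a * (b - c * g)); [apply: is_idealMl|ring].
Qed.

Lemma adjoin_sub J g a : J a -> adjoin J g a.
Proof. by exists 0; rewrite mul0r subr0. Qed.

Lemma adjoin_mem J g : is_ideal J -> adjoin J g g.
Proof. by move=> hJ; exists 1; rewrite mul1r subrr; apply: is_ideal0. Qed.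

(** An ideal that is maximal among those containing [J] and disjoint from
    [S] is prime. *)
Lemma krull_separation J S : is_ideal J -> S 1 ->
  (forall a b, S a -> S b -> S (a * b)) -> (forall a, J a -> ~ S a) ->
  exists P, (forall a, J a -> a \in P) /\ (forall a, S a -> a \notin P).
Proof.
move=> hJ S1 SM JS.
(* [J] is joined to each set so that the union of the empty chain is admissible. *)
pose good (X : classical_sets.set A) :=
  is_ideal (fun a => J a \/ X a) /\ forall a, X a -> ~ S a.
have [M [[Mi MS] Mmax]] : exists M : classical_sets.set A, good M /\
    forall B, classical_sets.proper M B -> ~ good B.
  apply: classical_sets.Zorn_bigcup => F Fgood Ftot; split; last first.
    by move=> a [X FX Xa]; apply: (Fgood _ FX).2.
  split; first by left; apply: is_ideal0.
    move=> a b [Ja|[X FX Xa]] [Jb|[Y FY Yb]].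
    - by left; apply: is_idealD.
    - by case: (is_idealD (Fgood _ FY).1 (or_introl Ja) (or_intror Yb)) => ?;
        [left|right; exists Y].
    - by case: (is_idealD (Fgood _ FX).1 (or_intror Xa) (or_introl Jb)) => ?;
        [left|right; exists X].
    - case: (Ftot _ _ FX FY) => sub.
        by case: (is_idealD (Fgood _ FY).1 (or_intror (sub _ Xa)) (or_intror Yb)) => ?;
          [left|right; exists Y].
      by case: (is_idealD (Fgood _ FX).1 (or_intror Xa) (or_intror (sub _ Yb))) => ?;
          [left|right; exists X].
  move=> a b [Jb|[X FX Xb]]; first by left; apply: is_idealMl.
  by case: (is_idealMl a (Fgood _ FX).1 (or_intror Xb)) => ?;
    [left|right; exists X].
pose M' a := J a \/ M a.
have M'S a : M' a -> ~ S a by case=> [/JS|/MS].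
have meets u : ~ M' u -> exists2 s, adjoin M' u s & S s.
  move=> nu; apply: contrapT => no; apply: (Mmax (adjoin M' u)).
    split=> [a Ma|sub]; first by apply: adjoin_sub; right.
    by apply: nu; right; apply/sub/adjoin_mem.
  split=> [|a h Sa]; last by apply: no; exists a.
  have -> : (fun a => J a \/ adjoin M' u a) = adjoin M' u.
    apply/funext => a; apply/propext; split=> [[Ja|//]|]; last by right.
    by apply: adjoin_sub; left.
  exact: is_ideal_adjoin.
have [||P hP] := prime_of_is_ideal Mi.
- by move=> h; apply: M'S h S1.
- move=> u v uv; apply: contrapT => /not_orP[/meets[s [c hs] Ss] /meets[t [d ht] St]].
  apply: M'S (SM _ _ Ss St).
  have -> : s * t = s * (t - d * v) + d * v * (s - c * u) + d * c * (u * v) by ring.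
  by do 2?[apply: (is_idealD Mi)]; apply: (is_idealMl _ Mi).
exists P; split=> a; first by move=> Ja; apply/hP; left.
by move=> Sa; apply/negP => /hP /M'S.
Qed.

Definition nzd J g : Prop := forall a, J (g * a) -> J a.

Lemma nzd_exp J g n : nzd J g -> nzd J (g ^+ n).
Proof.
move=> h; elim: n => [|n IH] a; first by rewrite expr0 mul1r.
by rewrite exprS -mulrA => /h /IH.
Qed.

(** The multiplicative set of the [y * g ^+ n] with [y] outside [M] misses
    [J] because [g] is a nonzerodivisor, so a prime separates the two. *)
Lemma nzd_prime_below J M g : is_ideal J -> (forall a, J a -> a \in M) ->
  nzd J g ->
  exists Q, [/\ forall a, J a -> a \in Q, {subset Q <= M} & g \notin Q].
Proof.
move=> hJ JM gJ.
pose S a := exists y n, y \notin M /\ a = y * g ^+ n.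
have [|||Q [JQ SQ]] := @krull_separation J S hJ.
- by exists 1, 0%N; rewrite expr0 mulr1 idealr1.
- move=> a b [y [n [yM ->]]] [z [k [zM ->]]]; exists (y * z), (n + k)%N.
  by split; [apply: prime_notinM | rewrite exprD; ring].
- move=> a Ja [y [n [yM e]]]; case/negP: yM; apply: JM.
  by apply: (nzd_exp (n := n) gJ); rewrite mulrC -e.
exists Q; split=> // [a aQ|].
  by apply: contraLR aQ => aM; apply: SQ; exists a, 0%N; rewrite expr0 mulr1.
by apply: SQ; exists 1, 1%N; rewrite expr1 mul1r idealr1.
Qed.

(** Modulo [J] a power of [g] is a multiple of [l], so whatever [l] kills is
    killed by a nonzerodivisor.  This transfers positive depth from one
    element of an ideal to another one. *)
Lemma nzd_adjoin_power J l g : is_ideal J ->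
  nzd J g -> (exists N, adjoin J l (g ^+ N)) -> nzd J l.
Proof.
move=> hJ gJ [N [c h]] a la; apply: (nzd_exp (n := N) gJ).
rewrite (_ : _ * a = (g ^+ N - c * l) * a + c * (l * a)); last by ring.
by apply: is_idealD => //; [apply: is_idealMr | apply: is_idealMl].
Qed.

Definition strict_sub P Q : Prop := {subset P <= Q} /\ ~ {subset Q <= P}.

Lemma strict_subP P Q g : {subset P <= Q} -> g \in Q -> g \notin P ->
  strict_sub P Q.
Proof. by move=> PQ gQ gP; split=> // /(_ _ gQ); rewrite (negPf gP). Qed.

Lemma prime_chain0 P : prime_chain_to P 0.
Proof. by exists (fun=> P); split=> // -[[|?] ?] [[|?] ?]. Qed.

Lemma prime_chainS P Q n : prime_chain_to P n -> strict_sub P Q ->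
  prime_chain_to Q n.+1.
Proof.
move=> [c [cP cm]] [PQ nQP].
exists (fun i : 'I_n.+2 => if unlift ord_max i is Some j then c j else Q).
split=> [i j|]; last by move=> a; rewrite unlift_none.
case: unliftP => [i' ->|->]; case: unliftP => [j' ->|->].
- by rewrite !lift_max; apply: cP.
- move=> _; have sub : {subset c i' <= P}.
    have [->|ne] := eqVneq i' ord_max; first by move=> a; rewrite cm.
    have [|h _ a /h] := cP i' ord_max; last by rewrite cm.
    have := ltn_ord i'; rewrite ltnS leq_eqVlt => /orP[/eqP e|//].
    by case/eqP: ne; apply: val_inj.
  by split=> [a /sub /PQ|h] //; apply: nQP => a /h /sub.
- by rewrite lift_max /= => h; have := leq_trans h (ltnW (ltn_ord j')); rewrite ltnn.
- by rewrite ltnn.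
Qed.

Lemma prime_chain_pred P n : prime_chain_to P n.+1 ->
  exists2 Q, prime_chain_to Q n & strict_sub Q P.
Proof.
move=> [c [cP cm]]; exists (c (widen_ord (leqnSn _) ord_max)).
  exists (fun i => c (widen_ord (leqnSn _) i)); split=> // i j ij.
  exact: cP.
have [h k] := cP (widen_ord (leqnSn _) ord_max) ord_max (leqnn _).
by split=> [a /h|sub]; rewrite ?cm //; apply: k => a; rewrite cm => /sub.
Qed.

(** Separating [y] modulo [(x)] inside [M] yields [Q1]; as [x] lies in [Q1],
    separating [x] modulo zero inside [Q1] yields [Q0]. *)
Lemma regular2_primes M x y : x \in M -> y \in M ->
  nzd (in_span [::]) x -> nzd (in_span [:: x]) y ->
  exists Q0 Q1, strict_sub Q0 Q1 /\ strict_sub Q1 M.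
Proof.
move=> xM yM hx hy.
have [|Q1 [Q1x Q1M yQ1]] := @nzd_prime_below _ M y (is_ideal_span _) _ hy.
  by move=> a; apply: (in_span_sub (is_ideal_prime M)) => z; rewrite inE => /eqP->.
have xQ1 : x \in Q1 by apply/Q1x/mem_in_span; rewrite inE.
have [|Q0 [_ Q01 xQ0]] := @nzd_prime_below _ Q1 x (is_ideal_span _) _ hx.
  by move=> a; apply: (in_span_sub (is_ideal_prime Q1)).
by exists Q0, Q1; split; [apply: strict_subP xQ0|apply: strict_subP yQ1].
Qed.

Lemma noetherian_fg J : noetherian A -> is_ideal J ->
  exists s, forall a, J a <-> in_span s a.
Proof.
move=> hA hJ; have [J1|nJ1] := pselect (J 1).
  exists [:: 1] => a; split=> _; first by apply/in_span1; exists a; rewrite mulr1.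
  by rewrite -[a]mulr1; apply: is_idealMl.
have [I hI] := idealr_of_is_ideal hJ nJ1.
by have [s hs] := hA I; exists s => a; rewrite -hI; apply: hs.
Qed.

(** Otherwise dependent choice produces a strictly increasing sequence of
    ideals, whose union is finitely generated and thus one of its terms. *)
Lemma noetherian_maximal (B : (A -> Prop) -> Prop) J0 : noetherian A ->
  is_ideal J0 -> B J0 ->
  exists J, [/\ is_ideal J, B J & forall J', is_ideal J' -> B J' ->
    (forall a, J a -> J' a) -> forall a, J' a -> J a].
Proof.
move=> hA hJ0 BJ0; apply: contrapT => nomax.
pose T := {J : A -> Prop | is_ideal J /\ B J}.
have step (t : T) : exists t' : T, (forall a, sval t a -> sval t' a) /\
    exists2 a, sval t' a & ~ sval t a.
  case: t => J [iJ BJ] /=; apply: contrapT => no; apply: nomax; exists J.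
  split=> // J' iJ' BJ' sub a J'a; apply: contrapT => nJa; apply: no.
  by exists (exist _ J' (conj iJ' BJ')); split=> //; exists a.
have [f hf] := choice step.
pose t n := iter n f (exist _ J0 (conj hJ0 BJ0)).
have mono m n a : (m <= n)%N -> sval (t m) a -> sval (t n) a.
  move=> /subnK <-; elim: (n - m)%N => [//|k IH] /IH h.
  by rewrite addSn; apply: (hf _).1.
pose U a := exists n, sval (t n) a.
have iU : is_ideal U.
  split; first by exists 0%N; apply: is_ideal0.
    move=> a b [m ha] [n hb]; exists (maxn m n).
    apply: (is_idealD (svalP (t _)).1); [apply: mono ha | apply: mono hb]; lia.
  by move=> a b [n hb]; exists n; apply: (is_idealMl _ (svalP (t _)).1).
have [s hs] := noetherian_fg hA iU.
have [N hN] : exists N, forall x, x \in s -> sval (t N) x.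
  have : forall x, x \in s -> U x by move=> x /mem_in_span /hs.
  elim: s {hs} => [|x s IH] h; first by exists 0%N.
  have [|N hN] := IH; first by move=> y ys; apply: h; rewrite inE ys orbT.
  have [n hn] : U x by apply: h; rewrite inE eqxx.
  exists (maxn n N) => y; rewrite inE => /orP[/eqP->|/hN hy].
    by apply: mono hn; lia.
  by apply: mono hy; lia.
have [_ [a ha []]] := hf (t N).
by apply: (in_span_sub (svalP (t N)).1 hN); apply/hs; exists N.+1.
Qed.

(** Noetherian induction: when [u * v] is in [J], a prime over [J] lies over
    [J + (u)] or over [J + (v)]. *)
Lemma finite_minimal_primes J : noetherian A -> is_ideal J ->
  exists Ps : seq (prime_idealr A),
    (forall P, List.In P Ps -> forall a, J a -> a \in P) /\
    (forall Q, (forall a, J a -> a \in Q) ->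
      exists2 P, List.In P Ps & {subset P <= Q}).
Proof.
move=> hA hJ.
pose good (J : A -> Prop) := exists Ps : seq (prime_idealr A),
  (forall P, List.In P Ps -> forall a, J a -> a \in P) /\
  (forall Q, (forall a, J a -> a \in Q) ->
    exists2 P, List.In P Ps & {subset P <= Q}).
apply: contrapT => bad.
have [K [iK bK Kmax]] := noetherian_maximal (B := fun J => ~ good J) hA hJ bad.
have K1 : ~ K 1.
  move=> K1; apply: bK; exists [::]; split=> // Q /(_ _ K1).
  by rewrite idealr1.
have goodK u : ~ K u -> good (adjoin K u).
  move=> nu; apply: contrapT => b; apply: nu.
  apply: (Kmax _ (is_ideal_adjoin u iK) b); last exact: adjoin_mem.
  by move=> a; apply: adjoin_sub.
have [Kp|nKp] := pselect (forall a b, K (a * b) -> K a \/ K b).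
  have [P hP] := prime_of_is_ideal iK K1 Kp.
  apply: bK; exists [:: P]; split=> [_ [<-|//] a|Q KQ]; first by move/hP.
  by exists P; [left | move=> a /hP /KQ].
have [u [v [uv nu nv]]] : exists u v, [/\ K (u * v), ~ K u & ~ K v].
  apply: contrapT => no; apply: nKp => a b ab; apply: contrapT => /not_orP[na nb].
  by apply: no; exists a, b.
have [Us [U1 U2]] := goodK u nu; have [Vs [V1 V2]] := goodK v nv.
apply: bK; exists (Us ++ Vs); split=> [P|Q KQ].
  by move=> /List.in_app_iff[/U1|/V1] h a Ka; apply/h/adjoin_sub.
have : u * v \in Q by apply: KQ.
have sub w : w \in Q -> forall a, adjoin K w a -> a \in Q.
  move=> wQ a [c /KQ h]; rewrite -[a](subrK (c * w)).
  by apply: rpredD => //; apply: idealMr.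
rewrite prime_idealrM => /orP[/sub/U2|/sub/V2] [P hP PQ].
  by exists P => //; apply/List.in_app_iff; left.
by exists P => //; apply/List.in_app_iff; right.
Qed.

End Ideals.

Lemma prime_kernel (A : comNzRingType) (B : idomainType) (f : {rmorphism A -> B}) :
  exists P : prime_idealr A, forall a, a \in P <-> f a = 0.
Proof.
apply: prime_of_is_ideal.
- split=> [|a b|a b]; first exact: rmorph0.
    by rewrite rmorphD => -> ->; rewrite addr0.
  by rewrite rmorphM => ->; rewrite mulr0.
- by rewrite rmorph1 => /eqP; rewrite oner_eq0.
- move=> a b; rewrite rmorphM => /eqP; rewrite mulf_eq0.
  by case/orP=> /eqP; [left|right].
Qed.

(** * Primes of a quotient ring *)

Section Quotient.
Variables (A : comNzRingType) (I : idealr A).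
Local Notation AI := {ideal_quot I}.

Lemma quot_eq a b : (\pi_AI a = \pi_AI b)%qT <-> a - b \in I.
Proof.
by split=> [/eqP|h]; [rewrite -Quotient.idealrBE|apply/eqP; rewrite -Quotient.idealrBE].
Qed.

Lemma quot_surj (x : AI) : exists a, (\pi_AI a)%qT = x.
Proof. by exists (repr x); rewrite reprK. Qed.

Lemma quotD a b : (\pi_AI (a + b) = \pi_AI a + \pi_AI b)%qT.
Proof. by rewrite !piE. Qed.

Lemma quotM a b : (\pi_AI (a * b) = \pi_AI a * \pi_AI b)%qT.
Proof. by rewrite !piE. Qed.

Lemma quot0 : (\pi_AI 0 = 0)%qT.
Proof. by rewrite !piE. Qed.

Lemma quot1 : (\pi_AI 1 = 1)%qT.
Proof. by rewrite !piE. Qed.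

Lemma quot_eq0 a : (\pi_AI a = 0)%qT <-> a \in I.
Proof. by rewrite -quot0 quot_eq subr0. Qed.

Lemma pull_prime (P : prime_idealr AI) :
  exists P' : prime_idealr A, forall a, a \in P' <-> (\pi_AI a)%qT \in P.
Proof.
apply: prime_of_is_ideal.
- split=> [|a b|a b]; first by rewrite quot0 idealr0.
    by rewrite quotD; apply: rpredD.
  by rewrite quotM; apply: idealMr.
- by rewrite quot1 idealr1.
- by move=> a b; rewrite quotM prime_idealrM => /orP.
Qed.

Lemma push_prime (P : prime_idealr A) : {subset I <= P} ->
  exists P' : prime_idealr AI, forall a, (\pi_AI a)%qT \in P' <-> a \in P.
Proof.
move=> IP; pose J (x : AI) := exists2 a, a \in P & (\pi_AI a)%qT = x.
have inJ a : J (\pi_AI a)%qT <-> a \in P.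
  split=> [[b bP /quot_eq/IP h]|aP]; last by exists a.
  by rewrite -[a](subKr b); apply: rpredB.
have [|||P' hP'] := @prime_of_is_ideal AI J.
- split=> [|x y|x y].
  + by rewrite -quot0; apply/inJ; apply: idealr0.
  + have [[a <-] [b <-]] := (quot_surj x, quot_surj y).
    by rewrite -quotD => /inJ ha /inJ hb; apply/inJ; apply: rpredD.
  + have [[a <-] [b <-]] := (quot_surj x, quot_surj y).
    by rewrite -quotM => /inJ hb; apply/inJ; apply: idealMr.
- by rewrite -quot1 => /inJ; rewrite idealr1.
- move=> x y; have [[a <-] [b <-]] := (quot_surj x, quot_surj y).
  by rewrite -quotM => /inJ; rewrite prime_idealrM => /orP[]/inJ; [left|right].
by exists P' => a; rewrite hP'.
Qed.

End Quotient.

(** * Noetherianity and dimension of polynomial rings *)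

Section Dimension.
Variables (F : fieldType) (n : nat).
Local Notation R := {mpoly F[n]}.

(** Induction on [j]: the monomials found for the earlier coordinates serve
    all [u] whose coordinate [j] is at least the maximum [C] of theirs, and each
    smaller value of that coordinate is treated separately. *)
Lemma dickson_prefix (j : nat) (L : 'X_{1..n} -> Prop) :
  exists G : seq 'X_{1..n}, (forall g, g \in G -> L g) /\
    (forall u, L u -> exists2 g, g \in G &
       forall i : 'I_n, (i < j)%N -> (g i <= u i)%N).
Proof.
elim: j L => [|j IH] L.
  have [[u Lu]|no] := pselect (exists u, L u).
    exists [:: u]; split=> [g|v Lv]; first by rewrite inE => /eqP->.
    by exists u; rewrite ?inE.
  by exists [::]; split=> // u Lu; case: no; exists u.
have [jn|nj] := ltnP j n; last first.
  have [G [GL hG]] := IH L; exists G; split=> // u /hG[g gG h].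
  by exists g => // i ij; apply: h; have := ltn_ord i; lia.
pose k : 'I_n := Ordinal jn.
have [G0 [G0L hG0]] := IH L.
pose C := \max_(g <- G0) g k.
have [G1 [G1L hG1]] : exists G : seq 'X_{1..n}, (forall g, g \in G -> L g) /\
    (forall u, L u -> (u k < C)%N -> exists2 g, g \in G &
       forall i : 'I_n, (i < j.+1)%N -> (g i <= u i)%N).
  elim: C => [|c [G [GL hG]]]; first by exists [::].
  have [G' [G'L hG']] := IH (fun u => L u /\ u k = c).
  exists (G ++ G'); split=> [g|u Lu].
    by rewrite mem_cat => /orP[/GL|/G'L[]].
  rewrite ltnS leq_eqVlt => /orP[/eqP uc|/hG[] // g gG h]; last first.
    by exists g; rewrite // mem_cat gG.
  have [//|g gG' h] := hG' u; exists g; first by rewrite mem_cat gG' orbT.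
  move=> i; rewrite ltnS leq_eqVlt => /orP[/eqP ij|/h//].
  have -> : i = k by apply: val_inj.
  by rewrite uc; case: (G'L _ gG') => _ ->.
exists (G0 ++ G1); split=> [g|u Lu].
  by rewrite mem_cat => /orP[/G0L|/G1L].
have [uC|Cu] := ltnP (u k) C.
  by have [g gG h] := hG1 u Lu uC; exists g; rewrite // mem_cat gG orbT.
have [g gG h] := hG0 u Lu; exists g; first by rewrite mem_cat gG.
move=> i; rewrite ltnS leq_eqVlt => /orP[/eqP ij|/h//].
have -> : i = k by apply: val_inj.
by apply: leq_trans Cu; rewrite /C (big_rem g) //= leq_maxl.
Qed.

Lemma dickson (L : 'X_{1..n} -> Prop) :
  exists G : seq 'X_{1..n}, (forall g, g \in G -> L g) /\
    (forall u, L u -> exists2 g, g \in G & (g <= u)%MM).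
Proof.
have [G [GL hG]] := dickson_prefix n L; exists G; split=> // u /hG[g gG h].
by exists g => //; apply/mnm_lepP => i; apply/h/ltn_ord.
Qed.

(** Hilbert's basis theorem: divide by polynomials of the ideal whose leading
    monomials are a Dickson basis of all its leading monomials. *)
Lemma mpoly_noetherian : noetherian R.
Proof.
move=> I; have hI := is_ideal_mem I.
have [G [GL hG]] := dickson (fun u => exists2 p : R, p \in I & p != 0 /\ mlead p = u).
have [s [sI hs]] : exists s : seq R, (forall p, p \in s -> p \in I) /\
    forall g, g \in G -> exists2 p, p \in s & p != 0 /\ mlead p = g.
  elim: G GL {hG} => [|g G IH] GL; first by exists [::].
  have [h gG|s [sI hs]] := IH; first by apply: GL; rewrite inE gG orbT.
  have [p pI pg] := GL g (mem_head _ _).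
  exists (p :: s); split=> [q|h]; rewrite inE => /orP[/eqP->|] //.
  - exact: sI.
  - by exists p; rewrite ?mem_head.
  - by move=> /hs[q qs hq]; exists q; rewrite // inE qs orbT.
exists s => a; split; last first.
  exact: in_span_sub hI sI.
elim/mleadrect: a => p IH pI.
have [->|p0] := eqVneq p 0; first exact: is_ideal0 (is_ideal_span s).
have [g gG lg] := hG (mlead p) (ex_intro2 _ _ p pI (conj p0 erefl)).
have [q qs [q0 lq]] := hs g gG.
pose c := mleadc p / mleadc q *: 'X_[(mlead p - mlead q)%MM] : R.
have cq : in_span s (c * q) by apply: (is_idealMl _ (is_ideal_span s)); apply: mem_in_span.
rewrite -[p](subrK (c * q)); apply: (is_idealD (is_ideal_span s)) => //.
have c0 : mleadc p / mleadc q != 0.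
  by rewrite mulf_neq0 ?invr_eq0 ?mleadc_eq0.
have lc : mlead c = (mlead p - mlead q)%MM by rewrite /c mleadZ // mleadXm.
have c1 : c != 0 by rewrite -mleadc_eq0 lc mcoeffZ mcoeffX eqxx mulr1.
have lcq : mlead (c * q) = mlead p by rewrite mleadM // lc submK // lq.
have ccq : (c * q)@_(mlead p) = mleadc p.
  rewrite (_ : (c * q)@_(mlead p) = (c * q)@_(mlead c + mlead q)); last by rewrite -mleadM ?lcq.
  by rewrite mleadcM lc mcoeffZ mcoeffX eqxx mulr1 divfK ?mleadc_eq0.
have pcI : p - c * q \in I by apply: rpredB => //; apply/idealMr/sI.
have [->|pc0] := eqVneq (p - c * q) 0; first exact: is_ideal0 (is_ideal_span s).
apply: IH => //; rewrite lt_neqAle; apply/andP; split.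
  apply: contraNneq pc0 => e; by rewrite -mleadc_eq0 e mcoeffB ccq subrr.
by have := mleadB_le p (c * q); rewrite lcq joinxx.
Qed.

Lemma msizeM_bound (p q : R) d e :
  (msize p <= d.+1 -> msize q <= e.+1 -> msize (p * q) <= (d + e).+1)%N.
Proof.
have [->|p0] := eqVneq p 0; first by rewrite mul0r msize0.
have [->|q0] := eqVneq q 0; first by rewrite mulr0 msize0.
rewrite msizeM //; move: (msize p) (msize q) => a b; lia.
Qed.

Lemma msizeX_bound (p : R) d k : (msize p <= d.+1 -> msize (p ^+ k) <= (d * k).+1)%N.
Proof.
move=> hp; elim: k => [|k IH]; first by rewrite expr0 msize1.
by rewrite exprS mulnS msizeM_bound.
Qed.

(** The products with exponents below [N] are [N ^ n.+1] in number, while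
    for large [N] there are fewer monomials of the degrees that occur. *)
Lemma algebraic_dependence (x : 'I_n.+1 -> R) :
  exists (N : nat) (c : {ffun 'I_n.+1 -> 'I_N} -> F),
    (exists a, c a != 0) /\
    \sum_a c a *: (\prod_i x i ^+ a i) = 0.
Proof.
pose D := (\sum_i msize (x i)).+1.
have xD i : (msize (x i) <= D.+1)%N by rewrite /D (bigD1 i) //=; lia.
(* all products have degree below M, and M ^ n = E ^ n * N ^ n < N ^ n.+1 *)
pose E := (n.+1 * D)%N; pose N := (E ^ n).+1; pose M := (E * N)%N.
pose T := {ffun 'I_n.+1 -> 'I_N}; pose B := {ffun 'I_n -> 'I_M}.
pose y (a : T) : R := \prod_i x i ^+ a i.
have yM a : (msize (y a) <= M)%N.
  have h : (msize (y a) <= (\sum_i D * a i).+1)%N.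
    rewrite /y; elim/big_rec2: _ => [|i d p _ hp]; first by rewrite msize1.
    by apply: msizeM_bound => //; apply: msizeX_bound.
  apply: leq_trans h _; apply: (@leq_ltn_trans (\sum_(i < n.+1) D * N.-1)).
    by apply: leq_sum => i _; rewrite leq_mul2l -ltnS prednK // ltn_ord orbT.
  rewrite sum_nat_const card_ord mulnA /M /E -/(E) /N /= mulnS.
  by rewrite -addn1 addnC leq_add2r muln_gt0.
pose mon (b : B) : 'X_{1..n} := [multinom (b i : nat) | i < n].
pose Mx := \matrix_(i < #|T|, j < #|B|) (y (enum_val i))@_(mon (enum_val j)).
have [v v0 vM] : exists2 v : 'rV_#|T|, v != 0 & v *m Mx = 0.
  have : (\rank Mx < #|T|)%N.
    apply: leq_ltn_trans (rank_leq_col _) _.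
    rewrite !card_ffun !card_ord /M expnMn expnS ltn_pmul2r ?expn_gt0 //.
  rewrite -subn_gt0 -mxrank_ker lt0n mxrank_eq0 => /rowV0Pn[v hv v0].
  by exists v => //; apply/sub_kermxP.
exists N, (fun a => v 0 (enum_rank a)); split.
  have [j vj] : exists j, v 0 j != 0 by apply/rV0Pn.
  by exists (enum_val j); rewrite enum_valK.
apply/mpolyP => m; rewrite mcoeff0 raddf_sum /=.
have [hm|hm] := leqP M (mdeg m).
  rewrite big1 // => a _; rewrite mcoeffZ memN_msupp_eq0 ?mulr0 //.
  by apply: msize_mdeg_ge; apply: leq_trans (yM a) hm.
have mM (i : 'I_n) : (m i < M)%N.
  by apply: leq_ltn_trans hm; rewrite mdegE (bigD1 i) //= leq_addr.
pose b : B := [ffun i => Ordinal (mM i)].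
have -> : m = mon b by apply/mnmP => i; rewrite mnmE ffunE.
have := congr1 (fun w : 'rV_#|B| => w 0 (enum_rank b)) vM; rewrite !mxE => h.
rewrite -[RHS]h (reindex_onto (@enum_val T T) enum_rank) /=; last first.
  by move=> i _; rewrite enum_rankK.
apply: eq_big => [i|i _]; first by rewrite enum_valK eqxx.
by rewrite mcoeffZ mxE enum_valK enum_rankK.
Qed.

(** Pick [x i] in the prime [i.+1] of a longer chain but not in the prime
    [i], and a polynomial relation between them.  A relation modulo the prime
    [i] can be divided by the least power of [x i] that it contains; modulo the
    prime [i.+1] only the terms attaining this power remain.  Finally one
    term is left, and its coefficient is a unit lying in a prime. *)
Lemma prime_chain_le (P : prime_idealr R) m : prime_chain_to P m -> (m <= n)%N.
Proof.
case=> c [cP _]; rewrite leqNgt; apply/negP => nm.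
pose q (i : nat) : prime_idealr R := c (inord i).
have qP i : (i <= n)%N -> strict_sub (q i) (q i.+1).
  by move=> hi; apply: cP; rewrite !inordK //; lia.
have [x xP] : exists x : nat -> R, forall i, (i <= n)%N ->
    x i \in q i.+1 /\ x i \notin q i.
  have [|x hx] := @choice nat R (fun i z => (i <= n)%N ->
    z \in q i.+1 /\ z \notin q i); last by exists x.
  move=> i; have [hi|] := leqP i n; last by exists 0.
  have [_ h] := qP i hi; apply: contrapT => no; apply: h => z z1.
  by apply: contrapT => /negP z0; apply: no; exists z.
have [N [w [[a0 wa0] rel]]] := algebraic_dependence (fun i : 'I_n.+1 => x i).
pose tail k (a : {ffun 'I_n.+1 -> 'I_N}) : R :=
  \prod_(i < n.+1 | (k <= i)%N) x i ^+ a i.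
(* T holds the exponents that are lexicographically least in the first k coordinates *)
have ind k : (k <= n.+1)%N -> exists T : {set {ffun 'I_n.+1 -> 'I_N}},
    [/\ exists a, a \in T, forall a, a \in T -> w a != 0,
     forall a b (i : 'I_n.+1), a \in T -> b \in T -> (i < k)%N -> a i = b i &
     \sum_(a in T) w a *: tail k a \in q k].
  elim: k => [_|k IH kn].
    exists [set a | w a != 0]; split=> //.
    - by exists a0; rewrite inE.
    - by move=> a; rewrite inE.
    - rewrite (_ : \sum_(a in _) _ = 0) ?idealr0 // -[RHS]rel.
      rewrite [RHS](bigID [pred a | w a != 0]) /= [X in _ + X]big1 ?addr0.
        by apply: eq_bigl => a; rewrite inE.
      by move=> a; rewrite negbK => /eqP ->; rewrite scale0r.
  have [T [[a1 aT] Tw Teq relT]] := IH (ltnW kn).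
  pose i : 'I_n.+1 := Ordinal kn; have [xk1 xk0] := xP k kn.
  pose l := [arg min_(a < a1 in T) (a i : nat)].
  have [lT lmin] : l \in T /\ forall a, a \in T -> (l i <= a i)%N.
    by rewrite /l; case: arg_minnP.
  pose u a := w a *: (x k ^+ (a i - l i) * tail k.+1 a).
  have uk : \sum_(a in T) u a \in q k.
    have : x k ^+ l i * \sum_(a in T) u a \in q k.
      rewrite mulr_sumr; congr (_ \in q k): relT; apply: eq_bigr => a /lmin la.
      rewrite /u -scalerAr; congr (_ *: _); rewrite mulrA -exprD subnKC //.
      rewrite /tail (bigD1 i) //=; congr (_ * _); apply: eq_bigl => j.
      by rewrite andbC -val_eqE /=; lia.
    by rewrite prime_idealrM => /orP[/prime_exp|//]; rewrite (negPf xk0).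
  have {}uk : \sum_(a in T) u a \in q k.+1 by apply: (qP k kn).1.
  exists [set a in T | a i == l i]; split.
  - by exists l; rewrite inE lT eqxx.
  - by move=> a; rewrite inE => /andP[/Tw].
  - move=> a b j; rewrite !inE => /andP[aT' /eqP ai] /andP[bT /eqP bi].
    rewrite ltnS leq_eqVlt => /orP[/eqP jk|]; last exact: Teq.
    by have -> : j = i by [apply: val_inj]; rewrite ai bi.
  - have h : \sum_(a in T | a i != l i) u a \in q k.+1.
      apply: rpred_sum => a /andP[aT' ne]; rewrite /u -mul_mpolyC.
      apply/idealMr; rewrite mulrC; apply/idealMr.
      have : (0 < a i - l i)%N.
        by rewrite subn_gt0 ltn_neqAle lmin // andbT eq_sym.
      by case: (a i - l i)%N => // e _; rewrite exprSr idealMr.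
    move: uk; rewrite (bigID (fun a : {ffun _} => a i == l i)) /= => uk.
    have := rpredB uk h; rewrite addrK; congr (_ \in q k.+1).
    apply: eq_big => a; first by rewrite inE.
    by move=> /andP[_ /eqP e]; rewrite /u e subnn expr0 mul1r.
have [T [[a aT] Tw Teq relT]] := ind n.+1 (leqnn _).
have Ta : T = [set a].
  apply/setP => b; rewrite inE; apply/idP/eqP => [bT|-> //].
  by apply/ffunP => i; apply: Teq.
move: relT; rewrite Ta big_set1 /tail big_pred0 => [|i]; last first.
  by apply/negbTE; rewrite -ltnNge.
move=> /(idealMr (w a)^-1%:MP); rewrite -mul_mpolyC mulr1 -mpolyCM.
by rewrite mulVf ?Tw // mpolyC1 idealr1.
Qed.

End Dimension.

(** * Homogeneous ideals and linear substitutions *)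

Section Homogeneous.
Variables (F : fieldType) (n : nat).
Local Notation R := {mpoly F[n]}.
Implicit Types (J : R -> Prop) (p q g a : R).
Local Notation pih := (pihomog mdeg).

Lemma homog_decomp p k : (msize p <= k)%N -> p = \sum_(i < k) pih i p.
Proof. exact: pihomog_partitionE. Qed.

Lemma pihomogM d e p q : p \is d.-homog -> pih (d + e) (p * q) = p * pih e q.
Proof.
move=> hp; pose k := maxn (msize q) e.+1.
have ek : (e < k)%N by rewrite /k leq_max leqnn orbT.
rewrite {1}(@homog_decomp q k) ?leq_maxl // mulr_sumr raddf_sum /=.
rewrite (bigD1 (Ordinal ek)) //= big1 ?addr0.
  by rewrite pihomog_dE // dhomogM // pihomogP.
move=> i ne; apply: (@pihomog_ne0 _ _ _ (d + i)); last first.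
  by rewrite dhomogM // pihomogP.
by apply: contraNneq ne => /addnI ei; apply/eqP/val_inj.
Qed.

Lemma pihomogM_lt d e p q : p \is d.-homog -> (e < d)%N -> pih e (p * q) = 0.
Proof.
move=> hp ed; rewrite {1}(@homog_decomp q (msize q)) // mulr_sumr raddf_sum /=.
apply: big1 => i _; apply: (@pihomog_ne0 _ _ _ (d + i)); last first.
  by rewrite dhomogM // pihomogP.
by lia.
Qed.

Lemma pihomog_0 p : pih 0 p = (p@_0%MM)%:MP.
Proof.
apply/mpolyP => m; rewrite mcoeffC.
have [->|m0] := eqVneq m 0%MM; last first.
  rewrite mulr0; apply: (dhomog_nemf_coeff (pihomogP _ 0 p)).
  by rewrite mdeg_eq0.
have e := congr1 (mcoeff 0%MM) (@homog_decomp p (msize p).+1 (leqnSn _)).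
rewrite mulr1 e [RHS]raddf_sum [RHS]big_ord_recl /= [X in _ + X]big1 ?addr0 // => i _.
by apply: (dhomog_nemf_coeff (pihomogP mdeg _ _)); rewrite /= ?mdeg0 /bump.
Qed.

Definition homog_ideal J : Prop :=
  is_ideal J /\ forall d p, J p -> J (pih d p).

Lemma homog_idealP J p : homog_ideal J -> (forall d, J (pih d p)) -> J p.
Proof.
by move=> [hJ _] h; rewrite (homog_decomp (leqnn (msize p))); apply: is_ideal_sum.
Qed.

Lemma homog_ideal_span (s : seq R) :
  (forall x, x \in s -> exists d, x \is d.-homog) -> homog_ideal (in_span s).
Proof.
move=> hs; have hJ := is_ideal_span s; split=> // e p [c ->].
rewrite raddf_sum /=; apply: is_ideal_sum => // i _.
have [d hd] := hs _ (mem_nth 0 (ltn_ord i)); rewrite mulrC.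
have [ed|de] := ltnP e d; first by rewrite (pihomogM_lt _ hd) //; apply: is_ideal0.
rewrite -(subnKC de) (pihomogM _ _ hd) mulrC; apply: is_idealMl => //.
by apply: mem_in_span; apply: mem_nth.
Qed.

Lemma homog_ideal_adjoin J g d : homog_ideal J -> g \is d.-homog ->
  homog_ideal (adjoin J g).
Proof.
move=> [hJ Jh] hg; split=> [|e p [c]]; first exact: is_ideal_adjoin.
move=> /(Jh e); rewrite raddfB /= mulrC.
have [ed|de] := ltnP e d.
  by rewrite (pihomogM_lt _ hg) // subr0; apply: adjoin_sub.
by rewrite -(subnKC de) (pihomogM _ _ hg) mulrC; exists (pih (e - d) c).
Qed.

(** The component of [y * g] in the degree of [g] is [y(0) * g]. *)
Lemma homog_ideal_unit J y g d : homog_ideal J -> y@_0%MM != 0 ->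
  g \is d.-homog -> J (y * g) -> J g.
Proof.
move=> [hJ Jh] y0 hg /(Jh d); rewrite mulrC -[d in pih d _]addn0.
rewrite (pihomogM _ _ hg) pihomog_0 mulrC => /(is_idealMl (y@_0%MM)^-1%:MP hJ).
by rewrite mulrA -mpolyCM mulVf // mul1r.
Qed.

(** Modulo the components of [a] already known to be in [J], the component
    of degree [e] of [y * a] is [y(0)] times that of [a]. *)
Lemma nzd_constant_term J y : homog_ideal J -> y@_0%MM != 0 -> nzd J y.
Proof.
move=> hJ y0 a ya; apply: (homog_idealP hJ) => e.
have hJi := hJ.1; elim/ltn_ind: e => e IH.
have [ae|ea] := leqP (msize a) e.
  rewrite (_ : pih e a = 0); first exact: is_ideal0.
  rewrite pihomogE big_seq_cond big1 // => m /andP[/msize_mdeg_lt h /eqP me].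
  by move: h; rewrite me ltnNge ae.
apply: (homog_ideal_unit hJ y0 (pihomogP _ e a)).
have := hJ.2 e _ ya; rewrite {1}(homog_decomp (leqnn (msize a))) mulr_sumr.
rewrite raddf_sum /= (bigD1 (Ordinal ea)) //= => h.
set s := \sum_(i < _ | _) _ in h.
have sJ : J s.
  apply: is_ideal_sum => // i ie; rewrite mulrC.
  have [lt|lt|eq] := ltngtP i e.
  - by apply: hJ.2; apply: is_idealMr => //; apply: IH.
  - by rewrite (pihomogM_lt _ (pihomogP _ i a)) //; apply: is_ideal0.
  - by case/eqP: ie; apply: val_inj.
have := is_idealB hJi h sJ; rewrite addrK.
have -> : pih e (y * pih e a) = (y@_0%MM)%:MP * pih e a.
  rewrite mulrC -{1}[e]addn0 (pihomogM _ _ (pihomogP _ e a)).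
  by rewrite pihomog_0 mulrC.
move=> /(is_idealMl (y * (y@_0%MM)^-1%:MP) hJi).
by rewrite -mulrA (mulrA _^-1%:MP) -mpolyCM mulVf // mul1r.
Qed.

Definition below_origin (Q : prime_idealr R) := forall a, a \in Q -> a@_0%MM = 0.

(** If [J] meets the set of the [y * g ^+ k] with [y(0)] nonzero, then the
    component of lowest degree of a common element is [g ^+ k] up to a unit;
    otherwise a prime separates.  Only primes inside the irrelevant ideal have
    to be examined, and these are controlled by their heights. *)
Lemma homog_radical J g d : homog_ideal J -> g \is d.-homog ->
  (forall Q : prime_idealr R, (forall a, J a -> a \in Q) -> below_origin Q ->
     g \in Q) ->
  exists N, J (g ^+ N).
Proof.
move=> hJ hg hQ; apply: contrapT => no.
pose S a := exists (y : R) k, y@_0%MM != 0 /\ a = y * g ^+ k.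
have [|||Q [JQ SQ]] := @krull_separation _ J S hJ.1.
- by exists 1, 0%N; rewrite mcoeff1 eqxx oner_neq0 mul1r.
- move=> a b [y [k [y0 ->]]] [z [l [z0 ->]]]; exists (y * z), (k + l)%N.
  by rewrite rmorphM mulf_neq0 // exprD; split=> //; ring.
- move=> a Ja [y [k [y0 e]]]; apply: no; exists k.
  by apply: (homog_ideal_unit hJ y0 (dhomogMn k hg)); rewrite -e.
have : g \in Q.
  apply: hQ => // a aQ; apply/eqP; apply: contraLR aQ => a0.
  by apply: SQ; exists a, 0%N; rewrite mulr1.
by apply/negP/SQ; exists 1, 1%N; rewrite mcoeff1 eqxx oner_neq0 mul1r expr1.
Qed.

(** Components of degree [e] do not see the multiples of [g ^+ e.+1]. *)
Lemma homog_separated J g d a : homog_ideal J -> g \is d.+1.-homog ->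
  (forall N, adjoin J (g ^+ N) a) -> J a.
Proof.
move=> hJ hg h; apply: (homog_idealP hJ) => e; have [c] := h e.+1.
move=> /(hJ.2 e); rewrite raddfB /= mulrC (pihomogM_lt _ (dhomogMn e.+1 hg)) ?subr0 //.
lia.
Qed.

(** If [b * h] is in [J] then [h] is a multiple of [a] modulo [J], and the
    cofactor inherits the property; so [h] is a multiple of every power of [a],
    and [homog_separated] applies. *)
Lemma nzd_swap J a d b : homog_ideal J -> a \is d.+1.-homog ->
  nzd J a -> nzd (adjoin J a) b -> nzd J b /\ nzd (adjoin J b) a.
Proof.
move=> hJ ha aJ baJ; have hJi := hJ.1.
have bJ : nzd J b.
  move=> h hb; apply: (homog_separated hJ ha) => N; elim: N => [|N [c hc]].
    by exists h; rewrite expr0 mulr1 subrr; apply: is_ideal0.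
  have : J (b * c).
    apply: (nzd_exp (n := N) aJ); rewrite (_ : _ * _ = b * h - b * (h - c * a ^+ N)).
      by apply: is_idealB => //; apply: is_idealMl.
    by ring.
  move=> /(adjoin_sub a)/baJ[e he]; exists e; rewrite exprS.
  rewrite (_ : _ - _ = (h - c * a ^+ N) + (c - e * a) * a ^+ N); last by ring.
  by apply: is_idealD => //; apply: is_idealMr.
split=> // m [m' h].
have [c hc] : adjoin J a m'.
  apply: baJ; exists m; rewrite (_ : _ - _ = - (a * m - m' * b)); last by ring.
  exact: is_idealN.
exists c; apply: aJ.
rewrite (_ : _ * _ = (a * m - m' * b) + b * (m' - c * a)); last by ring.
by apply: is_idealD => //; apply: is_idealMl.
Qed.

Lemma subst_congr J (s t : n.-tuple R) p : is_ideal J ->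
  (forall i, J (tnth s i - tnth t i)) -> J ((p \mPo s) - (p \mPo t)).
Proof.
move=> hJ h.
have hM a b a' b' : J (a - a') -> J (b - b') -> J (a * b - a' * b').
  move=> ha hb; rewrite (_ : _ - _ = (a - a') * b + a' * (b - b')); last by ring.
  by apply: is_idealD => //; [apply: is_idealMr|apply: is_idealMl].
rewrite !comp_mpolyEX -sumrB.
apply: is_ideal_sum => // m _; rewrite -scalerBr -mul_mpolyC.
apply: is_idealMl => //; rewrite !comp_mpolyX.
elim/big_rec2: _ => [|i u v _ IH]; first by rewrite subrr; apply: is_ideal0.
apply: (hM) => //; elim: (m i) => [|k IHk]; first by rewrite subrr; apply: is_ideal0.
by rewrite !exprS; apply: hM.
Qed.

Lemma subst_homog (t : n.-tuple R) p d : (forall i, tnth t i \is 1.-homog) ->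
  p \is d.-homog -> p \mPo t \is d.-homog.
Proof.
move=> ht /dhomogP hp; rewrite comp_mpolyEX big_seq; apply: rpred_sum => m /hp; rewrite /= mdegE => <-.
apply: rpredZ; rewrite comp_mpolyX.
elim/big_rec2: _ => [|i e u _ hu]; first exact: dhomog1.
by apply: dhomogM => //; have := dhomogMn (m i) (ht i); rewrite mul1n.
Qed.

Lemma subst_pihomog (t : n.-tuple R) p d : (forall i, tnth t i \is 1.-homog) ->
  pih d (p \mPo t) = pih d p \mPo t.
Proof.
move=> ht; pose k := maxn (msize p) d.+1.
have dk : (d < k)%N by rewrite /k leq_max leqnn orbT.
rewrite {1}(@homog_decomp p k) ?leq_maxl // (raddf_sum (comp_mpoly t)).
rewrite (raddf_sum (pihomog mdeg d)) (bigD1 (Ordinal dk)) //= big1 ?addr0.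
  by rewrite pihomog_dE // subst_homog // pihomogP.
move=> i ne; apply: (@pihomog_ne0 _ _ _ i); last first.
  by rewrite subst_homog // pihomogP.
by apply: contraNneq ne => ei; apply/eqP/val_inj.
Qed.

Lemma no_constant_term J a : is_ideal J -> (forall i, J 'X_i) -> a@_0%MM = 0 -> J a.
Proof.
move=> hJ hX a0; rewrite [a]mpolyE big_seq; apply: is_ideal_sum => // m.
rewrite mcoeff_msupp => am; rewrite -mul_mpolyC; apply: is_idealMl => //.
have : m != 0%MM by apply: contraNneq am => ->; rewrite a0.
rewrite -mdeg_eq0 mdegE sum_nat_eq0 => /forallPn[i /=].
rewrite -lep1mP => im; rewrite -(submK im) mpolyXD; exact: is_idealMl.
Qed.

End Homogeneous.

(** * General linear forms and regular sequences in three variables *)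

Section MoreIdeals.
Variable A : comNzRingType.
Implicit Types (J : A -> Prop) (P Q : prime_idealr A) (a b c g h x y z : A).

Lemma prime_chain_drop P n : prime_chain_to P n.+1 -> prime_chain_to P n.
Proof.
move=> [c [cP cm]]; exists (fun i => c (lift ord0 i)); split=> [i j ij|a].
  by apply: cP; rewrite !lift0.
rewrite -cm; congr (a \in c _); exact: val_inj.
Qed.

Lemma prime_chain_trunc P m n : (m <= n)%N -> prime_chain_to P n -> prime_chain_to P m.
Proof.
move=> /subnK <-; elim: (n - m)%N => // k IH; rewrite addSn => /prime_chain_drop.
exact: IH.
Qed.

Lemma prime_height_exists P d : (forall m, prime_chain_to P m -> (m <= d)%N) ->
  exists m, prime_height P m.
Proof.
move=> hd; pose b m := `[< prime_chain_to P m >].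
have b0 : exists m, b m by exists 0%N; apply/asboolP/prime_chain0.
have [|m /asboolP hm mmax] := ex_maxnP b0 (m := d).
  by move=> i /asboolP /hd.
by exists m; split=> // k hk; apply: mmax; apply/asboolP.
Qed.

Lemma eq_nzd J J' g : (forall a, J a <-> J' a) -> nzd J g -> nzd J' g.
Proof. by move=> e h a /e /h /e. Qed.

Lemma in_span_adjoin1 x a : in_span [:: x] a <-> adjoin (@in_span A [::]) x a.
Proof.
rewrite in_span1; split=> [[c ->]|[c /in_span0 /subr0_eq ->]]; exists c => //.
by apply/in_span0; rewrite subrr.
Qed.

Lemma in_span_rcons2 x y a :
  in_span [:: x; y] a <-> adjoin (in_span [:: x]) y a.
Proof.
rewrite in_span2; split=> [[c [d ->]]|[d /in_span1[c e]]].
  by exists d; apply/in_span1; exists c; rewrite addrK.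
by exists c, d; rewrite -e subrK.
Qed.

Lemma regular_sequence3P a b c :
  regular_sequence [:: a; b; c] <->
  [/\ ~ in_span [:: a; b; c] 1, nzd (in_span [::]) a, nzd (in_span [:: a]) b &
      nzd (in_span [:: a; b]) c].
Proof.
split=> [[h1 h]|[h1 ha hb hc]].
  by split=> // z; [apply: (h 0%N)|apply: (h 1%N)|apply: (h 2%N)].
by split=> // -[|[|[|]]] // z _; [apply: ha|apply: hb|apply: hc].
Qed.

End MoreIdeals.

Section ThreeVariables.
Variable F : fieldType.
Local Notation R := {mpoly F[3]}.
Hypothesis infF : forall s : seq F, exists t, t \notin s.

Definition i0 : 'I_3 := @Ordinal 3 0 isT.
Definition i1 : 'I_3 := @Ordinal 3 1 isT.
Definition i2 : 'I_3 := @Ordinal 3 2 isT.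
Local Notation x := ('X_i0 : R).
Local Notation y := ('X_i1 : R).
Local Notation z := ('X_i2 : R).

Lemma I3P (p : 'I_3 -> Prop) : p i0 -> p i1 -> p i2 -> forall i, p i.
Proof.
move=> p0 p1 p2 [[|[|[|//]]] h].
- by rewrite (_ : Ordinal h = i0) //; apply: val_inj.
- by rewrite (_ : Ordinal h = i1) //; apply: val_inj.
- by rewrite (_ : Ordinal h = i2) //; apply: val_inj.
Qed.

Lemma X_homog i : ('X_i : R) \is 1.-homog.
Proof. by rewrite dhomogX /= mdeg1. Qed.

Lemma X_constant_term i : ('X_i : R)@_0%MM = 0.
Proof. by rewrite mcoeffX mnm1_eq0. Qed.

Lemma subst_mod (J : R -> Prop) (a b c p : R) : is_ideal J ->
  J (x - a) -> J (y - b) -> J (z - c) -> J (p - (p \mPo [tuple a; b; c])).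
Proof.
move=> hJ ha hb hc; rewrite -{1}[p]comp_mpoly_id.
apply: subst_congr => //; apply: I3P; rewrite tnth_mktuple;
 by rewrite (tnth_nth 0).
Qed.

Lemma subst_X0 (a b c : R) : x \mPo [tuple a; b; c] = a.
Proof. by rewrite comp_mpolyXU. Qed.
Lemma subst_X1 (a b c : R) : y \mPo [tuple a; b; c] = b.
Proof. by rewrite comp_mpolyXU. Qed.
Lemma subst_X2 (a b c : R) : z \mPo [tuple a; b; c] = c.
Proof. by rewrite comp_mpolyXU. Qed.
Definition subst_var := (subst_X0, subst_X1, subst_X2).

Lemma X_neq0 i : ('X_i : R) != 0.
Proof. by rewrite -msize_poly_eq0 msizeX. Qed.

Lemma origin_exists : exists M : prime_idealr R, forall a, a \in M <-> a@_0%MM = 0.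
Proof. exact: (prime_kernel (@mcoeff 3 F 0%MM)). Qed.

Lemma line_prime : exists P : prime_idealr R,
  forall a, a \in P <-> in_span [:: x] a.
Proof.
have [P hP] := prime_kernel (comp_mpoly [tuple 0; y; z]).
exists P => a; rewrite hP; split=> [a0|/in_span1[c ->]]; last first.
  by rewrite rmorphM /= !subst_var mulr0.
rewrite -[a]subr0 -a0; apply: subst_mod; first exact: is_ideal_span.
- by rewrite subr0; apply: mem_in_span; rewrite inE.
- by rewrite subrr; apply: is_ideal0 (is_ideal_span _).
- by rewrite subrr; apply: is_ideal0 (is_ideal_span _).
Qed.

Lemma point_prime : exists P : prime_idealr R,
  (forall a, a \in P <-> in_span [:: x; y] a) /\
  (forall a, a \in P <-> a \mPo [tuple 0; 0; z] = 0).
Proof.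
have [P hP] := prime_kernel (comp_mpoly [tuple 0; 0; z]).
exists P; split=> // a; rewrite hP; split=> [a0|/in_span2[c [d ->]]]; last first.
  by rewrite rmorphD !rmorphM /= !subst_var !mulr0 addr0.
rewrite -[a]subr0 -a0; apply: subst_mod; first exact: is_ideal_span.
- by rewrite subr0; apply: mem_in_span; rewrite !inE eqxx.
- by rewrite subr0; apply: mem_in_span; rewrite !inE eqxx orbT.
- by rewrite subrr; apply: is_ideal0 (is_ideal_span _).
Qed.

Lemma zero_prime : exists P : prime_idealr R, forall a, a \in P <-> a = 0.
Proof. exact: (prime_kernel (GRing.RMorphism.clone _ _ (@idfun R) _)). Qed.

Lemma line_prime_chain : exists2 P : prime_idealr R, prime_chain_to P 1 &
  forall a, a \in P <-> in_span [:: x] a.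
Proof.
have [[Z hZ] [P hP]] := (zero_prime, line_prime); exists P => //.
apply: (prime_chainS (prime_chain0 Z)); apply: (@strict_subP _ _ _ x).
- by move=> a /hZ ->; apply: idealr0.
- by apply/hP/mem_in_span; rewrite inE.
- by apply/negP => /hZ/eqP; rewrite (negPf (X_neq0 _)).
Qed.

Lemma y_notin_line : ~ in_span [:: x] y.
Proof.
move=> /in_span1[c] /(congr1 (comp_mpoly [tuple 0; y; z])) /eqP.
by rewrite rmorphM /= !subst_var mulr0 (negPf (X_neq0 _)).
Qed.

Lemma z_notin_point : ~ in_span [:: x; y] z.
Proof.
move=> /in_span2[c [d]] /(congr1 (comp_mpoly [tuple 0; 0; z])) /eqP.
by rewrite rmorphD !rmorphM /= !subst_var !mulr0 addr0 (negPf (X_neq0 _)).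
Qed.

Lemma origin_chain (M : prime_idealr R) : (forall a, a \in M <-> a@_0%MM = 0) -> prime_chain_to M 3.
Proof.
move=> hM; have [L cL hL] := line_prime_chain; have [P [hP _]] := point_prime.
have cP : prime_chain_to P 2.
  apply: (prime_chainS cL); apply: (@strict_subP _ _ _ y).
  - move=> a /hL/in_span1[c ->]; apply/hP/in_span2; exists c, 0.
    by rewrite mul0r addr0.
  - by apply/hP/mem_in_span; rewrite !inE eqxx orbT.
  - by apply/negP => /hL /y_notin_line.
apply: (prime_chainS cP); apply: (@strict_subP _ _ _ z).
- move=> a /hP/in_span2[c [d ->]]; apply/hM.
  by rewrite rmorphD !rmorphM /= !X_constant_term !mulr0 addr0.
- by apply/hM; rewrite X_constant_term.
- by apply/negP => /hP /z_notin_point.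
Qed.

(** Otherwise the irrelevant ideal would be one further step of the
    chain. *)
Lemma chain3_below (Q : prime_idealr R) : prime_chain_to Q 3 -> below_origin Q ->
  forall i, 'X_i \in Q.
Proof.
move=> cQ bQ i; have [M hM] := origin_exists; apply: contraT => nX.
have /prime_chain_le : prime_chain_to M 4; last by [].
apply: (prime_chainS cQ); apply: (@strict_subP _ _ _ 'X_i) => //.
  by move=> a /bQ /hM.
by apply/hM; rewrite X_constant_term.
Qed.

(** The height of [Q] exists since chains of primes are bounded, so that it
    can be compared with the height of [I]. *)
Lemma height2_chain (I : idealr R) : height I 2 ->
  forall Q : prime_idealr R, {subset I <= Q} -> prime_chain_to Q 2.
Proof.
move=> [_ hI] Q IQ; have [m hm] := prime_height_exists (@prime_chain_le _ _ Q).
exact: prime_chain_trunc (hI _ _ IQ hm) hm.1.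
Qed.

(** The field is infinite and each prime excludes only finitely many
    parameters. *)
Lemma avoid_finitely_many_primes (Ps : seq (prime_idealr R)) (bad : prime_idealr R -> F -> Prop) :
  (forall P, List.In P Ps -> exists s : seq F, forall t, bad P t -> t \in s) ->
  exists t, forall P, List.In P Ps -> ~ bad P t.
Proof.
move=> h; have [s hs] : exists s : seq F, forall P, List.In P Ps ->
    forall t, bad P t -> t \in s.
  elim: Ps h => [|P Ps IH] h; first by exists [::].
  have [|s hs] := IH; first by move=> Q hQ; apply: h; right.
  have [s' hs'] := h P (or_introl erefl).
  exists (s' ++ s) => Q [<-|/hs hQ] t bt; rewrite mem_cat.
    by rewrite hs'.
  by rewrite (hQ _ bt) orbT.
have [t ts] := infF s; exists t => P /hs h1 /h1.
by rewrite (negPf ts).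
Qed.

(** With coefficients on a conic, any three of these forms are linearly
    independent; with [1] as coefficient of [z], they allow [z] to be
    eliminated. *)
Definition lin t : R := z + t%:MP * x + (t ^+ 2)%:MP * y.

Lemma lin_homog t : lin t \is 1.-homog.
Proof.
have h (c : F) i : c%:MP * ('X_i : R) \is 1.-homog.
  by rewrite mul_mpolyC; apply/rpredZ/X_homog.
by rewrite /lin !rpredD ?h ?X_homog.
Qed.

Lemma prime_scale (P : prime_idealr R) (c : F) a : c != 0 -> c%:MP * a \in P -> a \in P.
Proof.
move=> c0 /(idealMr c^-1%:MP); by rewrite mulrA -mpolyCM mulVf // mul1r.
Qed.

Lemma lin_finitely_many (P : prime_idealr R) i : 'X_i \notin P ->
  exists s : seq F, forall t, lin t \in P -> t \in s.
Proof.
move=> iP; have [[t1 h1]|no] := pselect (exists t, lin t \in P); last first.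
  by exists [::] => t ht; case: no; exists t.
have [[t2 [h2 ne]]|no] := pselect (exists t, lin t \in P /\ t != t1); last first.
  exists [:: t1] => t ht; rewrite inE; apply/eqP; apply: contrapT => /eqP ne.
  by apply: no; exists t.
exists [:: t1; t2] => t h3; rewrite !inE; apply: contraNT iP => /norP[ne1 ne2].
have two a b : a != b -> lin a \in P -> lin b \in P -> x + (a + b)%:MP * y \in P.
  move=> ab ha hb; apply: (@prime_scale _ (a - b)); first by rewrite subr_eq0.
  rewrite (_ : _ * _ = lin a - lin b); first exact: rpredB.
  by rewrite /lin !mpolyCD !mpolyCN !rmorphXn /=; ring.
have hy : y \in P.
  apply: (@prime_scale _ (t - t2)); first by rewrite subr_eq0.
  have := rpredB (two _ _ ne1 h3 h1) (two _ _ ne h2 h1); congr (_ \in P).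
  by rewrite !mpolyCD !mpolyCN; ring.
have hx : x \in P.
  by have := rpredB (two _ _ ne1 h3 h1) (idealMr (t + t1)%:MP hy); rewrite addrK.
have hz : z \in P.
  have := rpredB (rpredB h1 (idealMr (t1 ^+ 2)%:MP hy)) (idealMr t1%:MP hx).
  by congr (_ \in P); rewrite /lin; ring.
by move: i; apply: I3P.
Qed.

(** Among the finitely many primes below all primes over [J], let [l] avoid
    those other than the irrelevant ideal.  A prime over [J + (l)]
    properly inside the irrelevant ideal would properly contain one of these,
    which already have height two, and this is one step too many.  For the same
    reason every prime over [J] properly inside the irrelevant ideal occurs in
    the list, which thus contains the zeros of [J] in the projective plane. *)
Lemma general_linear_form (J : R -> Prop) : homog_ideal J ->
  (forall Q : prime_idealr R, (forall a, J a -> a \in Q) -> prime_chain_to Q 2) ->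
  exists t (Ps : seq (prime_idealr R)),
    [/\ forall i, exists N, adjoin J (lin t) ('X_i ^+ N),
        forall P i, List.In P Ps -> 'X_i \notin P -> lin t \notin P &
        forall Q : prime_idealr R, (forall a, J a -> a \in Q) -> below_origin Q ->
          forall i, 'X_i \notin Q -> exists2 P, List.In P Ps & P =i Q].
Proof.
move=> hJ J2.
have [Ps [JPs hPs]] := finite_minimal_primes (@mpoly_noetherian F 3) hJ.1.
have [|t ht] := @avoid_finitely_many_primes Ps (fun P t => (exists i, 'X_i \notin P) /\ lin t \in P).
  move=> P _; have [[i hi]|no] := pselect (exists i, ('X_i : R) \notin P).
    by have [s hs] := lin_finitely_many hi; exists s => t [_ /hs].
  by exists [::] => t [].
have lP P i : List.In P Ps -> 'X_i \notin P -> lin t \notin P.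
  by move=> hP hi; apply/negP => hl; apply: (ht P hP); split=> //; exists i.
exists t, Ps; split=> //.
  move=> i; apply: (homog_radical (homog_ideal_adjoin hJ (lin_homog t)) (X_homog i)).
  move=> Q JQ bQ; apply: contraT => iQ.
  have [P hP PQ] := hPs Q (fun a Ja => JQ a (adjoin_sub _ Ja)).
  have iP : 'X_i \notin P by apply: contra iQ; apply: PQ.
  have cQ : prime_chain_to Q 3.
    apply: (prime_chainS (J2 P (JPs P hP))); apply: (strict_subP PQ _ (lP P i hP iP)).
    by apply: JQ; apply: adjoin_mem hJ.1.
  by rewrite (chain3_below cQ bQ) in iQ.
move=> Q JQ bQ i iQ; have [P hP PQ] := hPs Q JQ; exists P => // a.
apply/idP/idP => [/PQ //|aQ]; apply: contraT => aP.
by rewrite (chain3_below (prime_chainS (J2 P (JPs P hP)) (strict_subP PQ aQ aP)) bQ) in iQ.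
Qed.

(** Exchange argument, starting from the regular sequence [x, y, B].  For
    general [t] the ideal [(x, B, C + t A)] still contains powers of the
    variables, hence of [y], which is regular modulo [(x, B)]; so [C + t A] may
    replace [y].  In the same way [A] may replace [x]. *)
Lemma generic_regular (b : nat) (A B C : R) :
  A \is b.+1.-homog -> B \is b.+1.-homog -> C \is b.+1.-homog ->
  (forall i, exists N, in_span [:: A; B; C] ('X_i ^+ N)) ->
  B \mPo [tuple 0; 0; z] != 0 ->
  exists t, regular_sequence [:: B; C + t%:MP * A; A].
Proof.
move=> hA hB hC hm B0.
have [P2 [P2s P2e]] := point_prime; have [P1 c1 hP1] := line_prime_chain.
have BP2 : B \notin P2 by apply/negP => /P2e /eqP; rewrite (negPf B0).
have BP1 : ~ in_span [:: x] B.
  move=> /in_span1[c e]; case/negP: BP2; apply/P2s/in_span2; exists c, 0.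
  by rewrite mul0r addr0.
have sJ := is_ideal_span [:: x; B].
have hJ : homog_ideal (in_span [:: x; B]).
  apply: homog_ideal_span => u; rewrite !inE => /orP[]/eqP->.
    by exists 1%N; apply: X_homog.
  by exists b.+1.
have [Ps [JPs hPs]] := finite_minimal_primes (@mpoly_noetherian F 3) sJ.
have [|t ht] := @avoid_finitely_many_primes Ps (fun P t =>
    (exists i, 'X_i \notin P) /\ C + t%:MP * A \in P).
  move=> P hP; have [[t1 [[i hi] h1]]|no] := pselect (exists t,
    (exists i, ('X_i : R) \notin P) /\ C + t%:MP * A \in P); last first.
    by exists [::] => t ht; case: no; exists t.
  exists [:: t1] => t [_ h2]; rewrite inE; apply: contraNT hi => ne.
  have hAP : A \in P.
    apply: (@prime_scale _ (t - t1)); first by rewrite subr_eq0.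
    have := rpredB h2 h1; congr (_ \in P).
    by rewrite mpolyCD mpolyCN; ring.
  have hCP : C \in P by have := rpredB h1 (idealMr t1%:MP hAP); rewrite addrK.
  have hBP : B \in P by apply: JPs => //; apply: mem_in_span; rewrite !inE eqxx orbT.
  have [N hN] := hm i; apply: (@prime_exp _ P _ N).
  by apply: (in_span_sub (is_ideal_prime P) _ hN) => u; rewrite !inE => /or3P[]/eqP->.
(* t keeps C + t A out of the primes of the list Ps that miss some variable *)
exists t; set C' := C + t%:MP * A.
have hC' : C' \is b.+1.-homog by rewrite /C' mul_mpolyC rpredD ?rpredZ.
have hpow i : exists N, adjoin (in_span [:: x; B]) C' ('X_i ^+ N).
  apply: (homog_radical (homog_ideal_adjoin hJ hC') (X_homog i)).
  move=> Q JQ bQ; apply: contraT => iQ.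
  have JQ' a : in_span [:: x; B] a -> a \in Q by move=> h; apply/JQ/adjoin_sub.
  have [P hP PQ] := hPs Q JQ'.
  have iP : 'X_i \notin P by apply: contra iQ; apply: PQ.
  have cP : prime_chain_to P 2.
    apply: (prime_chainS c1); apply: (@strict_subP _ _ _ B).
    - move=> a /hP1/in_span1[c ->]; apply/idealMr/JPs => //.
      by apply: mem_in_span; rewrite inE eqxx.
    - by apply: JPs => //; apply: mem_in_span; rewrite !inE eqxx orbT.
    - by apply/negP => /hP1.
  have cQ : prime_chain_to Q 3.
    apply: (prime_chainS cP); apply: (strict_subP PQ (g := C')).
      by apply: JQ; apply: adjoin_mem.
    by apply/negP => h; apply: (ht P hP); split=> //; exists i.
  by rewrite (chain3_below cQ bQ) in iQ.
have zero_h : homog_ideal (@in_span R [::]) by apply: homog_ideal_span.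
have x_h : homog_ideal (@in_span R [:: x]).
  apply: homog_ideal_span => u; rewrite inE => /eqP->.
  by exists 1%N; apply: X_homog.
have B_h : homog_ideal (@in_span R [:: B]).
  by apply: homog_ideal_span => u; rewrite inE => /eqP->; exists b.+1.
have nx : nzd (in_span [::]) x.
  move=> a /in_span0 /eqP; rewrite mulf_eq0 (negPf (X_neq0 _)) /= => /eqP->.
  exact/in_span0.
have ny : nzd (in_span [:: x]) y.
  by move=> a /hP1; rewrite prime_idealrM => /orP[/hP1/y_notin_line|/hP1].
have nB : nzd (adjoin (in_span [:: x]) y) B.
  move=> a /in_span_rcons2/P2s; rewrite prime_idealrM (negPf BP2) /= => /P2s.
  by move/in_span_rcons2.
have [nB1 ny1] := nzd_swap x_h (X_homog i1) ny nB.
have nC : nzd (in_span [:: x; B]) C'.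
  apply: (@nzd_adjoin_power _ _ C' y sJ).
    by apply: eq_nzd ny1 => a; rewrite in_span_rcons2.
  exact: hpow.
have nB2 : nzd (adjoin (in_span [::]) x) B.
  by apply: eq_nzd nB1 => a; rewrite in_span_adjoin1.
have [nB0 nxB] := nzd_swap zero_h (X_homog i0) nx nB2.
have nxB' : nzd (in_span [:: B]) x.
  by apply: eq_nzd nxB => a; rewrite in_span_adjoin1.
have eJ a : in_span [:: x; B] a <-> adjoin (in_span [:: B]) x a.
  rewrite in_span2 [X in _ <-> X](_ : _ = in_span [:: B; x] a); last first.
    by apply/propext; rewrite in_span_rcons2.
  by rewrite in_span2; split=> -[c [d ->]]; exists d, c; rewrite addrC.
have [nCB nxC] := nzd_swap B_h (X_homog i0) nxB' (eq_nzd eJ nC).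
have nA : nzd (in_span [:: B; C']) A.
  apply: (@nzd_adjoin_power _ _ A x); first exact: is_ideal_span.
    by apply: eq_nzd nxC => a; rewrite in_span_rcons2.
  have [N /in_span3[c [d [e h]]]] := hm i0; exists N, (c - e * t%:MP).
  by apply/in_span2; exists d, e; rewrite h /C'; ring.
apply/regular_sequence3P; split=> //.
have [M hM] := origin_exists.
move=> h; have : 1 \in M; last by rewrite idealr1.
have hH u : u \is b.+1.-homog -> u \in M.
  by move=> /dhomog_nemf_coeff h1; apply/hM/h1; rewrite /= mdeg0.
by apply: (in_span_sub (is_ideal_prime M) _ h) => u; rewrite !inE => /or3P[]/eqP->; apply: hH.
Qed.

End ThreeVariables.

(** * Vectors of minors of a 3 by 2 matrix *)

Section Triples.
Variable D : idomainType.
Implicit Types (u v w f a s : 'I_3 -> D).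

Definition dot v w : D := v i0 * w i0 + v i1 * w i1 + v i2 * w i2.

Definition cross v w (i : 'I_3) : D :=
  match val i with
  | 0 => v i1 * w i2 - v i2 * w i1
  | 1 => v i2 * w i0 - v i0 * w i2
  | _ => v i0 * w i1 - v i1 * w i0
  end.

Definition parallel v w : Prop := forall i j, v i * w j = v j * w i.

(** For nonzero [f] over a factorial domain this says that the entries have
    no common factor. *)
Definition primitive f : Prop :=
  forall u, parallel u f -> exists c, forall i, u i = c * f i.

Definition span3 f (a : D) : Prop := exists c, a = dot c f.

Lemma span3_mem f i : span3 f (f i).
Proof.
exists (fun j => (j == i)%:R).
by move: i; apply: I3P; rewrite /dot /= !(mul0r, mul1r, add0r, addr0).
Qed.

Lemma neq0_or_zero f : (exists i, f i != 0) \/ forall i, f i = 0.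
Proof.
have [|no] := pselect (exists i, f i != 0); first by left.
by right=> i; apply/eqP; apply: contrapT => /negP h; apply: no; exists i.
Qed.

Lemma parallel_cross v w : (forall i, cross v w i = 0) -> parallel v w.
Proof.
move=> h; move: (h i0) (h i1) (h i2); rewrite /cross /=.
move=> /subr0_eq h0 /subr0_eq h1 /subr0_eq h2.
by apply: I3P; apply: I3P.
Qed.

Lemma cross_dot v w : dot v (cross v w) = 0 /\ dot w (cross v w) = 0.
Proof. by rewrite /dot /cross /=; split; ring. Qed.

Lemma cross_cross u v w i :
  cross (cross u v) w i = v i * dot u w - u i * dot v w.
Proof. by move: i; apply: I3P; rewrite /cross /dot /=; ring. Qed.

(** Makes a vector vanish as soon as its cross products with [v] and [w] do
    and [cross v w] is nonzero. *)
Lemma mul_cross a v w i j :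
  a i * cross v w j = v i * cross a w j - w i * cross a v j
    + (i == j)%:R * dot w (cross a v).
Proof.
by move: i j; apply: I3P; apply: I3P; rewrite /cross /dot /=; ring.
Qed.

(** Both [a] and [w] are orthogonal to [f], so [cross a w] is parallel to
    [f] and hence a multiple [b f]; likewise [cross v a = c f].  The vector
    [a - b v - c w] then has zero cross product with [v] and with [w]. *)
Lemma syzygies_of_minors v w f a : (forall i, f i = cross v w i) ->
  (exists i, f i != 0) -> primitive f -> dot a f = 0 ->
  exists b c, forall i, a i = b * v i + c * w i.
Proof.
move=> fE [j fj] prim af.
have vf : dot v f = 0 by have := (cross_dot v w).1; rewrite /dot -!fE.
have wf : dot w f = 0 by have := (cross_dot v w).2; rewrite /dot -!fE.
have [b hb] : exists b, forall i, cross a w i = b * f i.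
  by apply: (prim (cross a w)); apply: parallel_cross => i; rewrite cross_cross af wf !mulr0 subrr.
have [c hc] : exists c, forall i, cross v a i = c * f i.
  by apply: (prim (cross v a)); apply: parallel_cross => i; rewrite cross_cross af vf !mulr0 subrr.
exists b, c => i.
pose a' i := a i - b * v i - c * w i.
have a'w k : cross a' w k = 0.
  transitivity (cross a w k - b * cross v w k).
    by move: k; apply: I3P; rewrite /cross /a' /=; ring.
  by rewrite hb fE subrr.
have a'v k : cross a' v k = 0.
  transitivity (- (cross v a k) + c * cross v w k).
    by move: k; apply: I3P; rewrite /cross /a' /=; ring.
  by rewrite hc fE addNr.
have : a' i * f j = 0.
  by rewrite fE mul_cross a'w a'v /dot !a'v !(mulr0, addr0, subr0).
move/eqP; rewrite mulf_eq0 (negPf fj) orbF /a' => /eqP h.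
by apply/eqP; rewrite -subr_eq0 opprD addrA h.
Qed.

End Triples.

(** * Restriction to a line of the projective plane *)

Section Reduction.
Variable F : fieldType.
Local Notation R := {mpoly F[3]}.
Local Notation x := ('X_i0 : R).
Local Notation y := ('X_i1 : R).
Local Notation z := ('X_i2 : R).
Implicit Types (f g u v w : 'I_3 -> R).

Lemma xpow_divides (X Y : R) N M : X * y ^+ M = Y * x ^+ N ->
  exists c, X = c * x ^+ N.
Proof.
elim: N X Y => [|N IH] X Y e; first by exists X; rewrite expr0 mulr1.
have [L hL] := line_prime F.
have hn : nzd (in_span [:: x]) y.
  by move=> a /hL; rewrite prime_idealrM => /orP[/hL/y_notin_line|/hL].
have /in_span1[X' hX] : in_span [:: x] X.
  apply: (nzd_exp (n := M) hn); rewrite mulrC e exprSr mulrA.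
  by apply/in_span1; exists (Y * x ^+ N).
have [c hc] : exists c, X' = c * x ^+ N.
  apply: (IH _ Y); apply: (mulIf (X_neq0 F i0)).
  by rewrite -[RHS]mulrA -exprSr -e hX mulrAC.
by exists c; rewrite hX hc exprSr mulrA.
Qed.

(** If [u] is parallel to [g], writing the two powers in terms of [g] gives
    [X * g j = x ^+ N * u j] and [Y * g j = y ^+ M * u j], hence
    [X * y ^+ M = Y * x ^+ N], and [x ^+ N] divides [X]. *)
Lemma primitive_of_powers g N M c c' :
  x ^+ N = dot c g -> y ^+ M = dot c' g -> primitive g.
Proof.
move=> hx hy u ug.
have transfer d j : dot d u * g j = dot d g * u j.
  by rewrite /dot !mulrDl -!mulrA !(ug _ j); rewrite !(mulrC (u j)).
have [j gj] : exists j, g j != 0.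
  have [//|g0] := neq0_or_zero g; have /eqP := hx; rewrite /dot.
  by rewrite !g0 !mulr0 !addr0 expf_eq0 (negPf (X_neq0 _ _)) andbF.
have [a ha] : exists a, dot c u = a * x ^+ N.
  apply: (@xpow_divides _ (dot c' u) _ M); apply: (mulIf gj).
  by rewrite [LHS]mulrAC [RHS]mulrAC !transfer -hx -hy; ring.
exists a => i; have := transfer c i; rewrite ha -hx mulrAC mulrC => h0.
have h := mulfI _ h0.
by apply/esym/h; rewrite expf_neq0 ?X_neq0.
Qed.

Variable t : F.
Local Notation l := (lin t).

(** Restriction to [l = 0] with [x] and [y] as coordinates, realized as a
    retraction of the polynomial ring with kernel [(l)]. *)
Definition elim_z : R -> R :=
  comp_mpoly [tuple x; y; - (t%:MP * x + (t ^+ 2)%:MP * y)].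
HB.instance Definition _ := GRing.RMorphism.on elim_z.
Local Notation phi := elim_z.

Lemma elim_z_homog (i : 'I_3) :
  tnth [tuple x; y; - (t%:MP * x + (t ^+ 2)%:MP * y)] i \is 1.-homog.
Proof.
have h (c : F) k : c%:MP * ('X_k : R) \is 1.-homog.
  by rewrite mul_mpolyC; apply/rpredZ/X_homog.
move: i; apply: I3P; rewrite (tnth_nth 0) /= ?X_homog //.
by rewrite rpredN rpredD ?h.
Qed.

Lemma elim_z_lin : phi l = 0.
Proof.
rewrite /lin !rmorphD !rmorphM /= /elim_z !subst_var !comp_mpolyC.
by ring.
Qed.

Lemma elim_z_mod p : exists q, p = phi p + q * l.
Proof.
have /in_span1[q hq] : in_span [:: l] (p - phi p).
  have hJ := is_ideal_span [:: l].
  apply: (subst_mod _ hJ); rewrite ?subrr; try exact: is_ideal0 hJ.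
  by rewrite opprK /lin addrA; apply: mem_in_span; rewrite inE.
by exists q; rewrite -hq addrC subrK.
Qed.

Lemma elim_zK p : phi (phi p) = phi p.
Proof.
have [q hq] := elim_z_mod p.
by rewrite {2}hq rmorphD rmorphM /= elim_z_lin mulr0 addr0.
Qed.

Lemma elim_z_eq0 p : phi p = 0 -> exists q, p = q * l.
Proof. by move=> h; have [q] := elim_z_mod p; rewrite h add0r; exists q. Qed.

Lemma elim_z_x : phi x = x. Proof. by rewrite /elim_z subst_var. Qed.
Lemma elim_z_y : phi y = y. Proof. by rewrite /elim_z subst_var. Qed.

Lemma lin_neq0 : l != 0.
Proof.
apply/eqP => /(congr1 (comp_mpoly [tuple 0; 0; z])) /eqP.
rewrite /lin !rmorphD !rmorphM rmorph0 /= !subst_var !mulr0 !addr0.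
by rewrite (negPf (X_neq0 _ _)).
Qed.

Lemma elim_z_dot u v : phi (dot u v) = dot (phi \o u) (phi \o v).
Proof. by rewrite /dot !rmorphD !rmorphM. Qed.

Lemma elim_z_cross u v i : phi (cross u v i) = cross (phi \o u) (phi \o v) i.
Proof.
by move: i; apply: I3P; rewrite /cross /= rmorphB !rmorphM.
Qed.

Lemma span3P f a : span3 f a <-> in_span [:: f i0; f i1; f i2] a.
Proof.
rewrite in_span3; split=> [[c ->]|[c [d [e ->]]]]; first by exists (c i0), (c i1), (c i2).
exists (fun i => match val i with 0 => c | 1 => d | _ => e end).
by rewrite /dot.
Qed.

Lemma elim_z_powers f (i : 'I_3) : (i < 2)%N ->
  (exists N, adjoin (span3 f) l ('X_i ^+ N)) ->
  exists N c, 'X_i ^+ N = dot c (phi \o f).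
Proof.
move=> i2 [N [q [c hc]]]; exists N, (phi \o c).
rewrite -elim_z_dot -hc rmorphB rmorphXn rmorphM /= elim_z_lin mulr0 subr0.
congr (_ ^+ N); move: i i2 {hc}; apply: I3P => // _.
  by rewrite elim_z_x.
by rewrite elim_z_y.
Qed.

Lemma primitive_elim_z f :
  (forall i, exists N, adjoin (span3 f) l ('X_i ^+ N)) -> primitive (phi \o f).
Proof.
move=> h; have [//|N [c hc]] := elim_z_powers (i := i0) _ (h i0).
have [//|M [c' hc']] := elim_z_powers (i := i1) _ (h i1).
exact: primitive_of_powers hc hc'.
Qed.

Lemma elim_z_neq0 f :
  (forall i, exists N, adjoin (span3 f) l ('X_i ^+ N)) -> exists i, phi (f i) != 0.
Proof.
move=> h; have [//|N [c hc]] := elim_z_powers (i := i0) _ (h i0).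
have [//|/= g0] := neq0_or_zero (phi \o f); have /eqP := hc; rewrite /dot /=.
by rewrite !g0 !mulr0 !addr0 expf_eq0 (negPf (X_neq0 _ _)) andbF.
Qed.

(** A vector [u] parallel to [f] is on the line a multiple of [f], and the
    remainder is [l] times another vector parallel to [f].  Iterating, [u] is a
    multiple of [f] modulo every power of [l], and homogeneity removes the
    remainder. *)
Lemma primitive_lift f d : (forall i, f i \is d.-homog) ->
  (forall i, exists N, adjoin (span3 f) l ('X_i ^+ N)) -> primitive f.
Proof.
move=> hf hpow; have pf := primitive_elim_z hpow; have [j fj] := elim_z_neq0 hpow.
have step v : parallel v f -> exists c w, parallel w f /\
    forall i, v i = c * f i + w i * l.
  move=> vf; have [|b hb] := pf (phi \o v).
    by move=> a k /=; rewrite -!rmorphM vf.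
  have hw i : exists q, v i - phi b * f i = q * l.
    apply: elim_z_eq0; rewrite rmorphB rmorphM /= elim_zK.
    by have := congr1 phi (hb i); rewrite rmorphM /= !elim_zK => ->; rewrite subrr.
  have [w hw'] := choice hw; exists (phi b), w.
  have e i : v i = phi b * f i + w i * l by rewrite -hw' addrC subrK.
  split=> // a k; apply: (mulIf lin_neq0).
  have := vf a k; rewrite !e => h.
  by apply/eqP; rewrite -subr_eq0; move/eqP: h; rewrite -subr_eq0;
     congr (_ == 0); ring.
move=> u uf.
have [c hc] : exists c, u j = c * f j.
  apply/in_span1; apply: (homog_separated _ (lin_homog t)).
    by apply: homog_ideal_span => a; rewrite inE => /eqP->; exists d.
  move=> N; have [c [w [_ hw]]] : exists c w, parallel w f /\
      forall i, u i = c * f i + w i * l ^+ N.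
    elim: N => [|N [c [w [wf hw]]]].
      by exists 0, u; split=> // i; rewrite mul0r add0r expr0 mulr1.
    have [c' [w' [wf' hw']]] := step w wf.
    exists (c + c' * l ^+ N), w'; split=> // i.
    by rewrite hw hw' exprS; ring.
  by exists (w j); apply/in_span1; exists c; rewrite hw addrK.
have fj0 : f j != 0 by apply: contraNneq fj => ->; rewrite rmorph0.
exists c => i; apply: (mulIf fj0); rewrite uf hc; ring.
Qed.

(** If [l * h = dot a f], then [a] restricts to a syzygy on the line, where
    it is a combination of the columns.  The columns being syzygies of [f],
    subtracting the combination leaves a multiple of [l] with the same
    product with [f]. *)
Lemma nzd_of_minors f v w : (forall i, f i = cross v w i) ->
  (forall i, exists N, adjoin (span3 f) l ('X_i ^+ N)) -> nzd (span3 f) l.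
Proof.
move=> fE hpow h [a ha].
have pf := primitive_elim_z hpow; have [j fj] := elim_z_neq0 hpow.
have vf : dot v f = 0 by have := (cross_dot v w).1; rewrite /dot -!fE.
have wf : dot w f = 0 by have := (cross_dot v w).2; rewrite /dot -!fE.
have [||||b [c hbc]] := @syzygies_of_minors _ (phi \o v) (phi \o w) (phi \o f) (phi \o a).
- by move=> i /=; rewrite -elim_z_cross fE.
- by exists j.
- exact: pf.
- by rewrite -elim_z_dot -ha rmorphM /= elim_z_lin mul0r.
have hq i : exists q, a i - (phi b * v i + phi c * w i) = q * l.
  apply: elim_z_eq0; rewrite rmorphB rmorphD !rmorphM /= !elim_zK.
  have := congr1 phi (hbc i); rewrite rmorphD !rmorphM /= !elim_zK => ->.
  by rewrite subrr.
have [q hq'] := choice hq; exists q; apply: (mulfI lin_neq0).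
have e i : a i = phi b * v i + phi c * w i + q i * l by rewrite -hq' addrC subrK.
rewrite ha.
transitivity (phi b * dot v f + phi c * dot w f + l * dot q f).
  by rewrite /dot !e; ring.
by rewrite vf wf !mulr0 !add0r.
Qed.

End Reduction.

(** * Cohen-Macaulayness of the quotient in terms of one nonzerodivisor *)

Section CohenMacaulay.
Variables (F : fieldType) (I : idealr {mpoly F[3]}).
Local Notation R := {mpoly F[3]}.
Local Notation RI := {ideal_quot I}.
Hypothesis homog_generated : homog_ideal (fun a => a \in I).
Hypothesis heightI : height I 2.

Lemma ideal_below_origin a : a \in I -> a@_0%MM = 0.
Proof.
move=> aI; apply/eqP; apply: contraT => a0.
have : (1 : R) \in I; last by rewrite idealr1.
by apply: (@homog_ideal_unit _ _ _ a 1 0 homog_generated a0); rewrite ?dhomog1 // mulr1.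
Qed.

(** The prime of [R] below [Q0] contains [I] and ends a chain of length two,
    and two more steps exceed the dimension of [R]. *)
Lemma no_chain_of_length_two (M Q0 Q1 : prime_idealr RI) :
  strict_sub Q0 Q1 -> strict_sub Q1 M -> False.
Proof.
move=> s01 s1M; have [P0 h0] := pull_prime Q0; have [P1 h1] := pull_prime Q1.
have [PM hM] := pull_prime M.
have str (P P' : prime_idealr R) (Q Q' : prime_idealr RI) :
    (forall a, a \in P <-> (\pi_RI a)%qT \in Q) ->
    (forall a, a \in P' <-> (\pi_RI a)%qT \in Q') -> strict_sub Q Q' -> strict_sub P P'.
  move=> hP hP' [s ns]; split=> [a /hP/s/hP' //|s']; apply: ns => b.
  by have [a <-] := quot_surj b; move=> /hP'/s'/hP.
have c0 : prime_chain_to P0 2.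
  apply: (height2_chain heightI) => a aI; apply/h0.
  by rewrite (quot_eq0 I a).2 // idealr0.
have := prime_chainS (prime_chainS c0 (str _ _ _ _ h0 h1 s01)) (str _ _ _ _ h1 hM s1M).
by move/prime_chain_le.
Qed.

Lemma noetherian_quotient : noetherian RI.
Proof.
move=> J; pose J' a := (\pi_RI a)%qT \in J.
have hJ' : is_ideal J'.
  split=> [|a b|a b]; rewrite /J'; first by rewrite quot0 idealr0.
    by rewrite quotD; apply: rpredD.
  by rewrite quotM; apply: idealMr.
have [s hs] := noetherian_fg (@mpoly_noetherian F 3) hJ'.
exists [seq (\pi_RI a)%qT | a <- s] => b; have [a <-] := quot_surj b; split.
  move=> /hs; apply: (@in_span_sub _ (fun a =>
    in_span [seq (\pi_RI a)%qT | a <- s] (\pi_RI a)%qT)).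
    have [k0 kD kM] := is_ideal_span [seq (\pi_RI a)%qT | a <- s].
    by split=> [|u v|u v]; rewrite ?quot0 ?quotD ?quotM //; [apply: kD|apply: kM].
  by move=> u us; apply: mem_in_span; apply: map_f.
apply: (in_span_sub (is_ideal_mem J)) => u /mapP[v vs ->].
by apply/hs; apply: mem_in_span.
Qed.

Lemma nzd_quotient g : nzd (fun a => a \in I) g <->
  nzd (in_span [::]) (\pi_RI g)%qT.
Proof.
split=> h b.
  have [a <-] := quot_surj b; rewrite -quotM => /in_span0/quot_eq0/h/quot_eq0 e.
  exact/in_span0.
move=> k; suff /in_span0/quot_eq0 : in_span [::] (\pi_RI b)%qT by [].
by apply/h/in_span0; rewrite -quotM; apply/quot_eq0.
Qed.

(** Depth and height are one at every maximal ideal: a maximal ideal inside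
    the irrelevant ideal equals it and contains [g], another one contains an
    element with nonzero constant term; both are nonzerodivisors, and neither
    a longer regular sequence nor a longer chain exists. *)
Lemma cohen_macaulay_of_nzd g : g@_0%MM = 0 -> nzd (fun a => a \in I) g ->
  arithmetically_cohen_macaulay I.
Proof.
move=> g0 gI; split; first exact: noetherian_quotient.
move=> M' maxM'; have [M hM] := pull_prime M'.
have [h [hM' hI]] : exists h, h \in M /\ nzd (fun a => a \in I) h.
  have [bM|nbM] := pselect (below_origin M); last first.
    have [h [hh h0]] : exists h, h \in M /\ h@_0%MM <> 0.
      apply: contrapT => no; apply: nbM => a aM; apply: contrapT => a0.
      by apply: no; exists a.
    by exists h; split=> //; apply: (nzd_constant_term homog_generated); apply/eqP.
  exists g; split=> //; have [O hO] := origin_exists F.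
  have [|O' hO'] := @push_prime _ I O.
    by move=> a /ideal_below_origin /hO.
  apply/hM; apply: (maxM' O'); last by apply/hO'/hO.
  by move=> b; have [a <-] := quot_surj b; move=> /hM/bM/hO/hO'.
have hq := (nzd_quotient h).1 hI.
exists 1%N; split; split.
- exists [:: (\pi_RI h)%qT]; split=> //.
    by move=> b; rewrite inE => /eqP->; apply/hM.
  split=> [/in_span1[c e]|[|//] a _].
    have : 1 \in M'; last by rewrite idealr1.
    by rewrite e; apply/idealMr/hM.
  exact: hq.
- move=> [|u [|v s]] // sub [_ reg].
  have [||a|a|Q0 [Q1 [s01 s1M]]] := @regular2_primes _ M' u v.
  + by apply: sub; rewrite inE eqxx.
  + by apply: sub; rewrite !inE eqxx orbT.
  + exact: (reg 0%N).
  + exact: (reg 1%N).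
  + by have := no_chain_of_length_two s01 s1M.
- have [|Q [_ QM hQ]] := @nzd_prime_below _ _ M' _ (is_ideal_span _) _ hq.
    by move=> a /in_span0 ->; apply: idealr0.
  by apply: (prime_chainS (prime_chain0 Q)); apply: (strict_subP QM _ hQ); apply/hM.
- move=> k ck; rewrite leqNgt; apply/negP => k1.
  have [Q1 c1 s1] := prime_chain_pred (prime_chain_trunc k1 ck); have [Q0 _ s0] := prime_chain_pred c1.
  exact: no_chain_of_length_two s0 s1.
Qed.

(** The irrelevant ideal has positive height modulo [I]: were it the only
    prime over [I] below itself, every prime over [I] would contain the
    variables and have height three.  So its depth is positive as well. *)
Lemma nzd_of_cohen_macaulay : arithmetically_cohen_macaulay I ->
  exists g, g@_0%MM = 0 /\ nzd (fun a => a \in I) g.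
Proof.
move=> [_ cm]; have [O hO] := origin_exists F.
have IO : {subset I <= O} by move=> a /ideal_below_origin /hO.
have [O' hO'] := push_prime IO.
have [|n [[[s [sO reg ss]] _] [_ hn]]] := cm O'.
  move=> J sub b; have [a <-] := quot_surj b => aJ; apply/hO'/hO/eqP.
  apply: contraT => a0; have : 1 \in J; last by rewrite idealr1.
  have h : (\pi_RI ((a@_0%MM)%:MP))%qT \in J.
    rewrite -[_%:MP](subKr a) quotD; apply: rpredD => //; apply/sub.
    by apply/hO'/hO; rewrite raddfN raddfB /= mcoeffC eqxx mulr1 subrr oppr0.
  rewrite -(quot1 I) (_ : (1 : R) = (a@_0%MM)^-1%:MP * (a@_0%MM)%:MP).
    by rewrite quotM; apply: idealMr.
  by rewrite -mpolyCM mulVf.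
have n0 : (0 < n)%N.
  apply: hn.
  have [Q [IQ [bQ [i iQ]]]] : exists Q : prime_idealr R, {subset I <= Q} /\
      below_origin Q /\ exists i, 'X_i \notin Q.
    apply: contrapT => no; have [[P [IP [_ hP]]] _] := heightI.
    have XP i : 'X_i \in P.
      have [|N hN] := homog_radical homog_generated (X_homog F i); last first.
        exact: (prime_exp (IP _ hN)).
      move=> Q IQ bQ; apply: contraT => iQ; case: no; exists Q.
      by split=> //; split=> //; exists i.
    suff : (3 <= 2)%N by [].
    apply: hP; apply: (origin_chain) => a; split=> [aP|]; last first.
      by exact: (no_constant_term (is_ideal_prime P) XP).
    apply/eqP; apply: contraT => a0; have : (1 : R) \in P; last by rewrite idealr1.
    have : (a@_0%MM)%:MP \in P.
      rewrite -[_%:MP](subKr a); apply: rpredB => //.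
      apply: (no_constant_term (is_ideal_prime P)) => //.
      by rewrite raddfB /= mcoeffC eqxx mulr1 subrr.
    move=> /(idealMr (a@_0%MM)^-1%:MP).
    by rewrite -mpolyCM mulVf.
  have [Q' hQ'] := push_prime IQ.
  apply: (prime_chainS (prime_chain0 Q')); apply: (@strict_subP _ _ _ (\pi_RI 'X_i)%qT).
  - by move=> b; have [a <-] := quot_surj b; move=> /hQ'/bQ/hO/hO'.
  - by apply/hO'/hO; rewrite X_constant_term.
  - by apply: contra iQ => /hQ'.
case: s ss reg sO => [ss|u s _ [_ reg] sO]; first by rewrite -ss in n0.
have [g hg] := quot_surj u; exists g; split.
  by apply/hO/hO'; rewrite hg; apply: sO; rewrite inE eqxx.
by apply/nzd_quotient; rewrite hg => b; apply: (reg 0%N).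
Qed.

End CohenMacaulay.

(** * From a regular syzygy to a Cohen-Macaulay quotient *)

Definition triple (D : Type) (a b c : D) (i : 'I_3) : D :=
  match val i with 0 => a | 1 => b | _ => c end.

(** Regularity at the last, middle and first place successively solves for
    [f3], [f2] and [f1]. *)
Lemma koszul_relation (D : comNzRingType) (A B C f1 f2 f3 : D) :
  regular_sequence [:: A; B; C] -> A * f1 + B * f2 + C * f3 = 0 ->
  exists p q r, [/\ f1 = B * r - C * p, f2 = C * q - A * r & f3 = A * p - B * q].
Proof.
move=> /regular_sequence3P[_ nA nB nC] e.
have /in_span2[p [q hf3]] : in_span [:: A; B] f3.
  apply: nC; apply/in_span2; exists (- f1), (- f2).
  apply/eqP; rewrite -subr_eq0; apply/eqP; rewrite -[RHS]e; ring.
have /in_span1[r hf2] : in_span [:: A] (f2 + C * q).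
  apply: nB; apply/in_span1; exists (- f1 - C * p).
  apply/eqP; rewrite -subr_eq0; apply/eqP; rewrite -[RHS]e hf3; ring.
have /in_span0 hf1 : in_span [::] (f1 + C * p + B * r).
  apply: nA; apply/in_span0; rewrite -[RHS]e hf3.
  have -> : f2 = r * A - C * q by rewrite -hf2 addrK.
  ring.
exists p, (- q), (- r); split.
- by apply/eqP; rewrite -subr_eq0 -[X in _ == X]hf1; apply/eqP; ring.
- by rewrite -[f2](addrK (C * q)) hf2; ring.
- by rewrite hf3; ring.
Qed.

Section Main.
Variable F : fieldType.
Hypothesis infF : forall s : seq F, exists t, t \notin s.
Local Notation R := {mpoly F[3]}.
Local Notation x := ('X_i0 : R).
Local Notation y := ('X_i1 : R).
Local Notation z := ('X_i2 : R).

Lemma homog1_const (g : R) d : g \is d.+1.-homog -> g@_0%MM = 0.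
Proof. by move=> /dhomog_nemf_coeff; apply; rewrite /= mdeg0. Qed.

Section Ideal.
Variables (I : idealr R) (f : 'I_3 -> R).
Hypothesis genI : generates [:: f i0; f i1; f i2] I.
Hypothesis homf : forall i, homogeneous (f i).
Hypothesis heightI : height I 2.

Lemma mem_span3 a : a \in I <-> span3 f a.
Proof. by rewrite span3P; apply: genI. Qed.

Lemma homog_generated : homog_ideal (fun a => a \in I).
Proof.
have -> : (fun a => is_true (a \in I)) = in_span [:: f i0; f i1; f i2].
  by apply/funext => a; apply/propext/genI.
by apply: homog_ideal_span => a; rewrite !inE => /or3P[]/eqP->; apply: homf.
Qed.

Lemma ideal_linear_form : exists t (Ps : seq (prime_idealr R)),
    [/\ forall i, exists N, adjoin (span3 f) (lin t) ('X_i ^+ N),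
        forall P i, List.In P Ps -> 'X_i \notin P -> lin t \notin P &
        forall Q : prime_idealr R, {subset I <= Q} -> below_origin Q ->
          forall i, 'X_i \notin Q -> exists2 P, List.In P Ps & P =i Q].
Proof.
have [t [Ps [h1 h2 h3]]] := general_linear_form infF homog_generated (height2_chain heightI).
exists t, Ps; split=> // i; have [N [c hc]] := h1 i; exists N, c.
exact/mem_span3.
Qed.

(** The generators are the minors of a matrix whose first column is the
    syzygy, so a general linear form is a nonzerodivisor. *)
Lemma cohen_macaulay_of_regular_syzygy A B C :
  regular_sequence [:: A; B; C] -> A * f i0 + B * f i1 + C * f i2 = 0 ->
  arithmetically_cohen_macaulay I.
Proof.
move=> reg syz; have [p [q [r [e0 e1 e2]]]] := koszul_relation reg syz.
have fE i : f i = cross (triple A B C) (triple q p r) i.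
  by move: i; apply: I3P.
have [t [Ps [hpow _ _]]] := ideal_linear_form.
apply: (cohen_macaulay_of_nzd homog_generated heightI (g := lin t)).
  exact: homog1_const (lin_homog t).
by apply: eq_nzd (nzd_of_minors fE hpow) => a; rewrite mem_span3.
Qed.

End Ideal.
End Main.

(** * The syzygy module is free of rank two *)

Section MuBasis.
Variable F : closedFieldType.
Hypothesis infF : forall s : seq F, exists t, t \notin s.
Local Notation R := {mpoly F[3]}.
Local Notation x := ('X_i0 : R).
Local Notation y := ('X_i1 : R).
Local Notation z := ('X_i2 : R).
Local Notation pih := (pihomog mdeg).

(** A prime over [K] contains the variables, hence every element without
    constant term. *)
Lemma origin_radical (K : R -> Prop) g : is_ideal K ->
  (forall i, exists N, K ('X_i ^+ N)) -> g@_0%MM = 0 -> exists N, K (g ^+ N).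
Proof.
move=> hK hX g0; apply: contrapT => no.
have [|||Q [KQ SQ]] := @krull_separation _ K (fun a => exists k, a = g ^+ k) hK.
- by exists 0%N; rewrite expr0.
- by move=> a b [k ->] [l ->]; exists (k + l)%N; rewrite exprD.
- by move=> a Ka [k e]; apply: no; exists k; rewrite -e.
have gQ : g \in Q.
  apply: (no_constant_term (is_ideal_prime Q)) => // i.
  by have [N hN] := hX i; apply: prime_exp (KQ _ hN).
by have := SQ g (ex_intro _ 1%N (esym (expr1 g))); rewrite gQ.
Qed.

Lemma subst_multiples (g : R) e (p : 'I_3 -> F) (m : R) (T : 3.-tuple R) :
  (forall i, tnth T i = p i *: m) -> g \is e.-homog ->
  g \mPo T = g.@[p] *: m ^+ e.
Proof.
move=> hT /dhomogP hg; rewrite comp_mpolyEX mevalE scaler_suml big_seq [RHS]big_seq.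
apply: eq_bigr => k /hg /= <-; rewrite -scalerA; congr (_ *: _).
rewrite comp_mpolyX mdegE.
elim/big_rec3: _ => [|i a b c _ ->]; first by rewrite scale1r.
by rewrite hT exprZn exprD -scalerAl -scalerAr scalerA.
Qed.

Variable t : F.
Local Notation l := (lin t).
Local Notation phi := (elim_z t).

(** The point of the line [l = 0] with first coordinates [p1] and [p2]. *)
Definition line_point (p1 p2 : F) : 'I_3 -> F :=
  triple p1 p2 (- (t * p1 + t ^+ 2 * p2)).

(** On the line [l = 0], the linear form vanishing exactly at the point with
    coordinates [p1] and [p2]. *)
Definition vanishing_form (p1 p2 : F) : R := p2%:MP * x - p1%:MP * y.

(** With [m = m1 x + m2 y] normalized to [1] at the point, the coordinates
    differ on the line from their values times [m] by multiples of
    [vanishing_form p1 p2]. *)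
Lemma eval_mod p1 p2 m1 m2 (g : R) e : m1 * p1 + m2 * p2 = 1 -> g \is e.-homog ->
  exists c, phi g - g.@[line_point p1 p2] *: (m1%:MP * x + m2%:MP * y) ^+ e
    = c * vanishing_form p1 p2.
Proof.
move=> hm hg; set m := (m1%:MP * x + _).
pose T := [tuple p1 *: m; p2 *: m; (- (t * p1 + t ^+ 2 * p2)) *: m].
rewrite -(@subst_multiples g e (line_point p1 p2) m T) //; last first.
  by apply: I3P; rewrite (tnth_nth 0).
have /in_span1[c hc] : in_span [:: vanishing_form p1 p2] (phi g - (g \mPo T)); last by exists c.
have hm' : m1%:MP * p1%:MP + m2%:MP * p2%:MP = 1 :> R.
  by rewrite -!mpolyCM -mpolyCD hm mpolyC1.
apply: subst_congr; first exact: is_ideal_span.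
have hx : x - p1 *: m = m2%:MP * vanishing_form p1 p2.
  by rewrite -mul_mpolyC -{1}[x]mul1r -hm' /m /vanishing_form; ring.
have hy : y - p2 *: m = - m1%:MP * vanishing_form p1 p2.
  by rewrite -mul_mpolyC -{1}[y]mul1r -hm' /m /vanishing_form; ring.
apply: I3P; rewrite !(tnth_nth 0) /=; apply/in_span1.
- by exists m2%:MP.
- by exists (- m1%:MP).
exists (- t%:MP * m2%:MP + (t ^+ 2)%:MP * m1%:MP).
transitivity (- (t%:MP * (x - p1 *: m) + (t ^+ 2)%:MP * (y - p2 *: m))).
  by rewrite -!mul_mpolyC mpolyCN mpolyCD !mpolyCM; ring.
by rewrite hx hy; ring.
Qed.

Lemma elim_z_vanishing_form p1 p2 : phi (vanishing_form p1 p2) = vanishing_form p1 p2.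
Proof.
by rewrite /vanishing_form rmorphB !rmorphM /= elim_z_x elim_z_y /elim_z !comp_mpolyC.
Qed.

Lemma vanishing_form_homog p1 p2 : vanishing_form p1 p2 \is 1.-homog.
Proof. by rewrite /vanishing_form !mul_mpolyC rpredB ?rpredZ ?X_homog. Qed.

Lemma vanishing_form_neq0 p1 p2 : (p1 != 0) || (p2 != 0) -> vanishing_form p1 p2 != 0.
Proof.
apply: contraTneq => h; have := congr1 (mcoeff U_(i0)%MM) h.
have := congr1 (mcoeff U_(i1)%MM) h.
rewrite !mcoeffB !mcoeffCM !mcoeffX !eq_mnm1 /= !mulr0 !mulr1 !mcoeff0 sub0r subr0.
by move=> /eqP; rewrite oppr_eq0 => /eqP -> ->; rewrite eqxx.
Qed.

(** A polynomial without roots is constant.  If [g] were a nonzero constant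
    on both affine charts of the line, comparing the charts would give
    [s ^+ e = 1] for all nonzero [s]. *)
Lemma form_root (g : R) e : g \is e.-homog -> (0 < e)%N \/ g = 0 ->
  exists p1 p2, (p1 != 0) || (p2 != 0) /\ g.@[line_point p1 p2] = 0.
Proof.
move=> hg [e0|->]; last by exists 1, 0; rewrite oner_neq0 meval0.
have rest (a b : F * F) : exists P : {poly F}, forall s,
    P.[s] = g.@[line_point (a.1 * s + b.1) (a.2 * s + b.2)].
  pose c (i : 'I_3) : {poly F} :=
    (line_point a.1 a.2 i)%:P * 'X + (line_point b.1 b.2 i)%:P.
  exists (mmap polyC c g) => s.
  rewrite /mmap mevalE horner_sum; apply: eq_bigr => m _.
  rewrite hornerM hornerC; congr (_ * _).
  rewrite /mmap1 horner_prod; apply: eq_bigr => i _; rewrite horner_exp; congr (_ ^+ _).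
  rewrite /c !hornerE; move: i; apply: I3P; rewrite /line_point /triple /= ?hornerE //.
  by ring.
(* the charts with second, respectively first, coordinate 1 *)
have [P hP] := rest (1, 0) (0, 1); have [Q hQ] := rest (0, 1) (1, 0).
have const_or_root (P0 : {poly F}) : (exists s, P0.[s] = 0) \/ exists c, P0 = c%:P.
  have [/eqP/size_poly1P[c _ ->]|] := eqVneq (size P0) 1%N; first by right; exists c.
  by move=> /closed_rootP[s /rootP hs]; left; exists s.
have [[s hs]|[c hc]] := const_or_root P.
  by exists (1 * s + 0), (0 * s + 1); rewrite -hP hs mul0r add0r oner_neq0 orbT.
have [[s hs]|[c' hc']] := const_or_root Q.
  by exists (0 * s + 1), (1 * s + 0); rewrite -hQ hs mul0r add0r oner_neq0.
have scale (s : F) v w : (forall i, v i = s * w i) -> g.@[v] = s ^+ e * g.@[w].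
  move=> hv; rewrite !mevalE mulr_sumr big_seq [RHS]big_seq; apply: eq_bigr => m.
  move/dhomogP: hg => hg' /hg' /= <-; rewrite mulrCA; congr (_ * _).
  rewrite mdegE; elim/big_rec3: _ => [|i a b d _ ->]; first by rewrite mul1r.
  by rewrite hv exprMn exprD; ring.
have key s : s != 0 -> c = s ^+ e * c'.
  move=> s0; have := hP s; have := hQ s^-1; rewrite hc hc' !hornerC => -> ->.
  apply: scale; apply: I3P; rewrite /line_point /triple /=; by field.
have [a] := infF [:: 0; 1]; rewrite !inE => /norP[a0 a1].
(* a nonzero r whose e-th power is not 1 *)
have [r /rootP] : exists r, root ('X^e - a%:P) r.
  by apply/closed_rootP; rewrite size_XnsubC // -lt0n; case: (e) e0.
rewrite !hornerE => /subr0_eq ra.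
have r0 : r != 0.
  by apply: contra_neq a0 => r0; rewrite -ra r0 expr0n eqn0Ngt e0.
have := key r r0; have := key 1 (oner_neq0 _).
rewrite expr1n mul1r ra => -> /eqP; rewrite -subr_eq0 -{1}[c']mul1r -mulrBl.
rewrite mulf_eq0 subr_eq0 eq_sym (negPf a1) /= => /eqP c0.
exists (0 * 0 + 1), (1 * 0 + 0); rewrite -hQ hc' c0 horner0.
by rewrite mul0r add0r oner_neq0.
Qed.

Variables (f : 'I_3 -> R) (d : nat).
Hypothesis homf : forall i, f i \is d.-homog.
Hypothesis hpow : forall i, exists N, adjoin (span3 f) l ('X_i ^+ N).
Hypothesis nzdl : nzd (span3 f) l.

Definition homog_syzygy e (v : 'I_3 -> R) : Prop :=
  dot v f = 0 /\ forall i, v i \is e.-homog.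

(** The quotient by the linear form is a syzygy on the line.  It lifts to a
    syzygy because [l] is a nonzerodivisor modulo [f], and the component in the
    right degree of the lift is again a syzygy with the same restriction. *)
Lemma syzygy_divide p1 p2 u e : (p1 != 0) || (p2 != 0) -> homog_syzygy e u ->
  (forall i, exists c, phi (u i) = c * vanishing_form p1 p2) -> (exists i, phi (u i) != 0) ->
  exists e' v, [/\ e = e'.+1, homog_syzygy e' v &
    forall i, phi (u i) = vanishing_form p1 p2 * phi (v i)].
Proof.
move=> hp [uf hu] hc [j uj]; have [c {}hc] := choice hc.
have hc' i : phi (u i) = vanishing_form p1 p2 * phi (c i).
  by rewrite -elim_zK hc rmorphM /= elim_z_vanishing_form mulrC.
have /elim_z_eq0[h eh] : phi (dot c f) = 0.
  have uf' : dot (phi \o u) (phi \o f) = 0 by rewrite -elim_z_dot uf rmorph0.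
  apply: (mulfI (vanishing_form_neq0 hp)); rewrite mulr0 -uf' elim_z_dot.
  by rewrite /dot /= !hc'; ring.
have [r hr] : span3 f h by apply: nzdl; exists c; rewrite eh mulrC.
pose v0 i := c i - r i * l.
have v0f : dot v0 f = 0.
  transitivity (dot c f - dot r f * l); last by rewrite eh hr subrr.
  by rewrite /dot /v0; ring.
have pv0 i : phi (v0 i) = phi (c i).
  by rewrite /v0 rmorphB rmorphM /= elim_z_lin mulr0 subr0.
have comp i : phi (u i) = pih e (vanishing_form p1 p2 * phi (c i)).
  by rewrite -hc' pihomog_dE //; apply: subst_homog (elim_z_homog t) _.
case: e => [|e] in hu comp *.
  by case/eqP: uj; rewrite comp (pihomogM_lt _ (vanishing_form_homog p1 p2)).
exists e, (fun i => pih e (v0 i)); split=> //.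
  split=> [|i]; last exact: pihomogP.
  transitivity (pih (d + e) (dot v0 f)); last by rewrite v0f raddf0.
  rewrite /dot !(mulrC (v0 _)) !(raddfD (pihomog mdeg (d + e))) /=.
  by rewrite !(pihomogM _ _ (homf _)); ring.
move=> i; rewrite comp -[e.+1]add1n (pihomogM _ _ (vanishing_form_homog p1 p2)) -pv0.
by rewrite /elim_z subst_pihomog //; apply: elim_z_homog.
Qed.

Definition koszul (k i : 'I_3) : R := cross (fun j => (j == k)%:R) f i.

Lemma koszul_syzygy k : homog_syzygy d (koszul k).
Proof.
split; first by have := (cross_dot (fun j => (j == k)%:R) f).2; rewrite /dot mulrC
  [_ * koszul k i1]mulrC [_ * koszul k i2]mulrC.
have hb (b : bool) j : b%:R * f j \is d.-homog.
  by case: b; rewrite ?mul1r ?mul0r ?rpred0.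
by apply: I3P; rewrite /koszul /cross /= rpredB ?hb.
Qed.

(** The relevant 2 by 2 minors of the Koszul syzygies are the squares of the
    [f j], which do not all vanish on the line; so these syzygies are not all
    multiples of one vector. *)
Lemma koszul_rank (s : 'I_3 -> R) :
  exists k, ~ exists c, forall i, phi (koszul k i) = c * s i.
Proof.
have [j fj] := elim_z_neq0 hpow; apply: contrapT => no.
have ex k : exists c, forall i, phi (koszul k i) = c * s i.
  by apply: contrapT => h; apply: no; exists k.
have [c hc] := choice ex; case/eqP: fj.
have : phi (f j) * phi (f j) = 0; last by move/eqP; rewrite mulf_eq0 orbb => /eqP.
have par k m a b : phi (koszul k a * koszul m b - koszul k b * koszul m a) = 0.
  by rewrite rmorphB !rmorphM /= !hc; ring.
rewrite -rmorphM; move: j; apply: I3P.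
- by rewrite -(par i1 i2 i1 i2); congr (phi _); rewrite /koszul /cross /=; ring.
- by rewrite -(par i2 i0 i2 i0); congr (phi _); rewrite /koszul /cross /=; ring.
- by rewrite -(par i0 i1 i0 i1); congr (phi _); rewrite /koszul /cross /=; ring.
Qed.

Lemma minimal_degree (p : nat -> Prop) n : p n ->
  exists m, p m /\ forall k, p k -> (m <= k)%N.
Proof.
move=> pn; have ex : exists n, `[< p n >] by exists n; apply/asboolP.
have [m /asboolP pm hm] := ex_minnP ex; exists m; split=> // k /asboolP.
exact: hm.
Qed.

(** Let [v] be a syzygy of least degree among those nonzero on the line, and
    [w] one of least degree among those that are not multiples of [v] there.
    Their cross product is [q f] for a form [q].  If [q] had a zero on the
    line, then at this point either [v] or a combination of [w] and [v]
    involving [w] would vanish, and could be divided by a linear form, against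
    the choice of degrees.  So [q] is a nonzero constant. *)
Lemma hilbert_burch_matrix :
  exists b1 b2 v w, [/\ (b1 <= b2)%N, (b1 + b2 = d)%N, homog_syzygy b1 v,
    homog_syzygy b2 w & forall i, f i = cross v w i].
Proof.
pose S1 e := exists v, homog_syzygy e v /\ exists i, phi (v i) != 0.
have S1d : S1 d.
  have [k hk] := koszul_rank (fun=> 0); exists (koszul k).
  split; first exact: koszul_syzygy.
  have [//|h] := neq0_or_zero (phi \o koszul k).
  by case: hk; exists 0 => i; rewrite mul0r; apply: h.
have [b1 [[v [hv v0]] min1]] := minimal_degree S1d.
pose S2 e := exists w, homog_syzygy e w /\
  ~ exists c, forall i, phi (w i) = c * phi (v i).
have S2d : S2 d.
  have [k hk] := koszul_rank (phi \o v); exists (koszul k).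
  by split; first exact: koszul_syzygy.
have [b2 [[w [hw nw]] min2]] := minimal_degree S2d.
have b12 : (b1 <= b2)%N.
  apply: min1; exists w; split=> //; have [//|h] := neq0_or_zero (phi \o w).
  by case: nw; exists 0 => i; rewrite mul0r; apply: h.
have pf := primitive_lift homf hpow.
have [q hq] : exists q, forall i, cross v w i = q * f i.
  apply: (pf (cross v w)); apply: parallel_cross => i.
  by rewrite cross_cross hv.1 hw.1 !mulr0 subrr.
have hcr i : cross v w i \is (b1 + b2).-homog.
  have hh a b : v a * w b \is (b1 + b2).-homog by apply: dhomogM; [apply: hv.2|apply: hw.2].
  by move: i; apply: I3P; rewrite /cross /= rpredB ?hh.
have [j fj0] := elim_z_neq0 hpow.
have fj : f j != 0 by apply: contraNneq fj0 => ->; rewrite rmorph0.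
have [e [hqe he]] : exists e, q \is e.-homog /\ (q = 0 \/ (b1 + b2 = d + e)%N).
  have eq1 := pihomog_dE (hcr j); rewrite hq mulrC in eq1.
  have [lt|ge] := ltnP (b1 + b2) d.
    have q0 : q = 0.
      apply: (mulfI fj); rewrite mulr0 -eq1.
      by rewrite (pihomogM_lt _ (homf j)).
    by exists 0%N; rewrite q0 rpred0; split=> //; left.
  exists (b1 + b2 - d)%N; split; last by right; rewrite subnKC.
  rewrite -(subnKC ge) (pihomogM _ _ (homf j)) in eq1.
  by rewrite -(mulfI fj eq1) pihomogP.
have nbad : ~ ((0 < e)%N \/ q = 0).
  move=> /(form_root hqe)[p1 [p2 [hp qp]]].
  have [m1 [m2 hm]] : exists m1 m2, m1 * p1 + m2 * p2 = 1.
    have [p10|p10] := eqVneq p1 0.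
      rewrite p10 eqxx /= in hp; exists 0, p2^-1.
      by rewrite mul0r add0r mulVf.
    by exists p1^-1, 0; rewrite mul0r addr0 mulVf.
  pose p := line_point p1 p2; pose m : R := m1%:MP * x + m2%:MP * y.
  have ev g n : g \is n.-homog -> exists c, phi g = g.@[p] *: m ^+ n + c * vanishing_form p1 p2.
    by move=> /(eval_mod hm)[c hc]; exists c; rewrite -hc addrC subrK.
  have pm : phi m = m.
    by rewrite /m rmorphD !rmorphM /= elim_z_x elim_z_y /elim_z !comp_mpolyC.
  have hmm : m \is 1.-homog by rewrite /m !mul_mpolyC rpredD ?rpredZ ?X_homog.
  (* v does not vanish at the point, by minimality of its degree *)
  have [k vk] : exists k, (v k).@[p] != 0.
    have [//|vp0] := neq0_or_zero (fun i => (v i).@[p]).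
    have [|e' [v' [eb hv' vv']]] := syzygy_divide hp hv _ v0.
      move=> i; have [c hc] := ev _ _ (hv.2 i); exists c.
      by rewrite hc vp0 scale0r add0r.
    have : (b1 <= e')%N.
      apply: min1; exists v'; split=> //; have [i vi] := v0; exists i.
      by apply: contraNneq vi => h; rewrite vv' h mulr0.
    by rewrite eb ltnn.
  pose c := (w k).@[p] / (v k).@[p].
  have wc i : (w i).@[p] = c * (v i).@[p].
    apply: (mulIf vk); rewrite /c mulrAC divfK //.
    pose V i := (v i).@[p]; pose W i := (w i).@[p].
    have : parallel V W.
      apply: parallel_cross => a; have := congr1 (meval p) (hq a).
      rewrite mevalM qp mul0r => <-.
      by move: a; apply: I3P; rewrite /cross /V /W /= mevalB !mevalM.
    by move=> h; rewrite -/(V k) -/(V i) -/(W k) -/(W i) [RHS]mulrC h mulrC.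
  (* the combination of w and v vanishing at the point, made homogeneous by m *)
  pose u i := w i - c%:MP * m ^+ (b2 - b1) * v i.
  have hu : homog_syzygy b2 u.
    split=> [|i].
      transitivity (dot w f - c%:MP * m ^+ (b2 - b1) * dot v f).
        by rewrite /dot /u; ring.
      by rewrite hv.1 hw.1 mulr0 subrr.
    rewrite /u rpredB ?(hw.2 i) // -mulrA mul_mpolyC rpredZ //.
    by have := dhomogM (dhomogMn (b2 - b1) hmm) (hv.2 i); rewrite mul1n subnK.
  have pu i : phi (u i) = phi (w i) - c%:MP * m ^+ (b2 - b1) * phi (v i).
    have pc : phi c%:MP = c%:MP by rewrite /elim_z comp_mpolyC.
    by rewrite /u rmorphB 2!rmorphM rmorphXn /= pm pc.
  have [||e' [u' [eb hu' uu']]] := syzygy_divide hp hu.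
  - move=> i; have [a ha] := ev _ _ (hv.2 i); have [b hb] := ev _ _ (hw.2 i).
    exists (b - c%:MP * m ^+ (b2 - b1) * a); rewrite pu ha hb wc -!mul_mpolyC mpolyCM.
    by rewrite -{1}(subnK b12) exprD; ring.
  - have [//|h] := neq0_or_zero (phi \o u); case: nw.
    exists (c%:MP * m ^+ (b2 - b1)) => i.
    by apply/eqP; rewrite -subr_eq0 -pu; apply/eqP/h.
  have [[c' hc']|n2] := pselect (exists c', forall i, phi (u' i) = c' * phi (v i)).
    apply: nw; exists (vanishing_form p1 p2 * c' + c%:MP * m ^+ (b2 - b1)) => i.
    rewrite mulrDl -mulrA -hc' -uu' pu; ring.
  have : (b2 <= e')%N by apply: min2; exists u'.
  by rewrite eb ltnn.
have e0 : e = 0%N by case: (e) nbad => // n h; case: h; left.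
have q0 : q != 0 by apply/eqP => h; apply: nbad; right.
have [k hk] : exists k, q = k%:MP.
  by exists q@_0%MM; rewrite -pihomog_0 pihomog_dE //; rewrite e0 in hqe.
have k0 : k != 0 by apply: contraNneq q0 => h; rewrite hk h mpolyC0.
exists b1, b2, v, (fun i => k^-1%:MP * w i); split=> //.
- by case: he => [/eqP|->]; [rewrite (negPf q0)|rewrite e0 addn0].
- split=> [|i]; last by rewrite mul_mpolyC rpredZ ?(hw.2 i).
  by transitivity (k^-1%:MP * dot w f); [rewrite /dot; ring|rewrite hw.1 mulr0].
move=> i; transitivity (k^-1%:MP * cross v w i).
  by rewrite hq hk mulrA -mpolyCM mulVf // mul1r.
by move: i; apply: I3P; rewrite /cross /=; ring.
Qed.

End MuBasis.

(** * Complete intersections at the minimal primes *)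

Lemma clear_denominators (K : fieldType) (p r a1 b1 p' r' a2 b2 : K) :
  r != 0 -> b1 != 0 -> r' != 0 -> b2 != 0 ->
  r * b1 * (r' * b2) * (p / r * (a1 / b1) + p' / r' * (a2 / b2))
    = p * (r' * b2) * a1 + p' * (r * b1) * a2.
Proof. by move=> h1 h2 h3 h4; field; rewrite h1 h2 h3 h4. Qed.

Section LocallyCompleteIntersection.
Variable D : idomainType.
Local Notation "a %:F" := (@FracField.tofrac D a).

Lemma det3_low_rank (a b c e : 'I_3 -> D) :
  let N i k := a i * c k + b i * e k in
  N i0 i0 * (N i1 i1 * N i2 i2 - N i1 i2 * N i2 i1)
  - N i0 i1 * (N i1 i0 * N i2 i2 - N i1 i2 * N i2 i0)
  + N i0 i2 * (N i1 i0 * N i2 i1 - N i1 i1 * N i2 i0) = 0.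
Proof. by move=> N; rewrite /N; ring. Qed.

(** If all entries of the matrix lay in [P], clearing denominators in a
    factorization of [f] through two generators of the localization would
    give a 3 by 3 matrix [N] of rank two acting on [f] like a diagonal matrix
    [de] with entries outside [P].  The rows of [de - N] are syzygies, hence
    combinations of the columns and congruent to zero modulo [P]; so the
    determinant of [N] could not vanish. *)
Lemma minors_locally_two_generated (I : idealr D) (P : prime_idealr D)
    (f v w : 'I_3 -> D) :
  (forall a, a \in I <-> span3 f a) ->
  (forall a, dot a f = 0 -> exists b c, forall i, a i = b * v i + c * w i) ->
  (exists g1 g2, forall q, in_loc_ideal I P q <->
     exists u u', [/\ in_loc_ring P u, in_loc_ring P u' & q = u * g1 + u' * g2]) ->
  exists i, v i \notin P \/ w i \notin P.
Proof.
move=> genI syz [g1 [g2 hg]]; apply: contrapT => no.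
have vP i : v i \in P by apply: contraT => h; case: no; exists i; left.
have wP i : w i \in P by apply: contraT => h; case: no; exists i; right.
have one_loc : in_loc_ring P 1.
  by exists 1, 1; rewrite idealr1 divr1 rmorph1.
have zero_loc : in_loc_ring P 0.
  by exists 0, 1; rewrite idealr1 rmorph0 mul0r.
have neq0 b : b \notin P -> b%:F != 0.
  by move=> bP; rewrite tofrac_eq0; apply: contraNneq bP => ->; apply: idealr0.
have [a1 [b1 [a1I b1P e1]]] : in_loc_ideal I P g1.
  by apply/hg; exists 1, 0; rewrite mul1r mul0r addr0.
have [a2 [b2 [a2I b2P e2]]] : in_loc_ideal I P g2.
  by apply/hg; exists 0, 1; rewrite mul1r mul0r add0r.
have [[c hc] [c' hc']] := ((genI _).1 a1I, (genI _).1 a2I).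
have hf i : exists p : D * D * D, p.1.1 \notin P /\
    p.1.1 * f i = p.1.2 * a1 + p.2 * a2.
  have fI : f i \in I by apply/genI/span3_mem.
  have [u [u' [[p [r [rP ->]]] [p' [r' [r'P ->]]] e]]] :
      exists u u', [/\ in_loc_ring P u, in_loc_ring P u' & (f i)%:F = u * g1 + u' * g2].
    by apply/hg; exists (f i), 1; rewrite idealr1 divr1.
  exists (r * b1 * (r' * b2), p * (r' * b2), p' * (r * b1)) => /=.
  split; first by rewrite !prime_notinM.
  apply/eqP; rewrite -tofrac_eq; apply/eqP; rewrite !(rmorphD, rmorphM) /= e e1 e2.
  by apply: clear_denominators; apply: neq0.
have [p hp] := choice hf.
pose al i := (p i).1.2; pose be i := (p i).2; pose de i := (p i).1.1.
pose N i k := al i * c k + be i * c' k.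
have NP i k : (i == k)%:R * de i - N i k \in P.
  pose a k := (i == k)%:R * de i - N i k.
  have af : dot a f = 0.
    transitivity (de i * f i - (al i * dot c f + be i * dot c' f)).
      by rewrite /a /N; move: i @a; apply: I3P => a; rewrite /a /dot /=; ring.
    by rewrite -hc -hc' (hp i).2 subrr.
  have [x [y hxy]] := syz a af.
  by rewrite -/(a k) hxy; apply: rpredD; apply: idealMr.
have off i k : i != k -> N i k \in P.
  by move=> ik; have := NP i k; rewrite (negPf ik) mul0r sub0r rpredN.
have diag i : N i i \notin P.
  apply: contra (hp i).1 => h; have := rpredD (NP i i) h.
  by rewrite eqxx mul1r subrK.
have := det3_low_rank al be c c'; rewrite /= -!/(N _ _) => det0.
have : N i0 i0 * (N i1 i1 * N i2 i2) \in P.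
  rewrite (_ : _ * _ = N i0 i0 * N i1 i2 * N i2 i1
     + (N i1 i0 * N i2 i2 - N i1 i2 * N i2 i0) * N i0 i1
     - (N i1 i0 * N i2 i1 - N i1 i1 * N i2 i0) * N i0 i2).
    by rewrite !(rpredB, rpredD) ?idealMr ?off.
  by apply/eqP; rewrite -subr_eq0 -[X in _ == X]det0; apply/eqP; ring.
by apply/negP; rewrite !prime_notinM.
Qed.

End LocallyCompleteIntersection.

(** * Existence of a regular syzygy *)

Section Minimality.
Variables (F : fieldType) (n : nat).
Local Notation R := {mpoly F[n]}.

(** Take the components of degree [d] on both sides. *)
Lemma in_span_scalars (s : seq R) d a : (forall u, u \in s -> u \is d.-homog) ->
  a \is d.-homog -> in_span s a ->
  exists c : 'I_(size s) -> F, a = \sum_i c i *: s`_i.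
Proof.
move=> hs ha [c e]; exists (fun i => (c i)@_0%MM).
rewrite -[LHS](pihomog_dE ha) e raddf_sum /=; apply: eq_bigr => i _.
rewrite mulrC -{1}[d]addn0 (pihomogM _ _ (hs _ (mem_nth _ (ltn_ord i)))).
by rewrite pihomog_0 mulrC mul_mpolyC.
Qed.

Lemma in_span_trans (s u : seq R) a : (forall q, q \in s -> in_span u q) ->
  in_span s a -> in_span u a.
Proof. exact: in_span_sub (is_ideal_span u). Qed.

(** For forms of one degree minimality means linear independence over the
    field: two generators of [I] would span the three independent ones. *)
Lemma minimally_generates_same_degree (I : idealr R) (d : nat) (f g : 'I_3 -> R) :
  (forall i, f i \is d.-homog) -> (forall i, g i \is d.-homog) ->
  minimally_generates [:: f i0; f i1; f i2] I ->
  generates [:: g i0; g i1; g i2] I ->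
  minimally_generates [:: g i0; g i1; g i2] I.
Proof.
move=> hf hg [genf minf] geng; split; first exact: geng.
move=> u sub genu.
have [hsize heq] := size_subseq_leqif sub.
have [e|ne] := eqVneq (size u) 3%N; first by apply/eqP; rewrite -heq e.
have hu q : q \in u -> q \is d.-homog.
  by move=> /(mem_subseq sub); rewrite !inE => /or3P[]/eqP->.
have fu i : exists c : 'I_(size u) -> F, f i = \sum_j c j *: u`_j.
  apply: (in_span_scalars hu (hf i)); apply/genu/genf/mem_in_span.
  by move: i; apply: I3P; rewrite !inE eqxx ?orbT.
have [c hc] := choice fu.
pose Mx := \matrix_(i < 3, j < size u) c i j.
have [v v0 vM] : exists2 v : 'rV_3, v != 0 & v *m Mx = 0.
  have : (\rank Mx < 3)%N.
    by apply: leq_ltn_trans (rank_leq_col _) _; rewrite ltn_neqAle ne.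
  rewrite -subn_gt0 -mxrank_ker lt0n mxrank_eq0 => /rowV0Pn[v hv v0].
  by exists v => //; apply/sub_kermxP.
have rel : \sum_(i < 3) v 0 i *: f i = 0.
  under eq_bigr => i _ do rewrite hc scaler_sumr.
  rewrite exchange_big big1 //= => j _.
  have := congr1 (fun m : 'rV_(size u) => m 0 j) vM; rewrite !mxE => h.
  rewrite -[RHS](scale0r u`_j) -[in RHS]h scaler_suml; apply: eq_bigr => i _.
  by rewrite mxE scalerA.
have {rel} rel : v 0 i0 *: f i0 + v 0 i1 *: f i1 + v 0 i2 *: f i2 = 0.
  rewrite -[RHS]rel !big_ord_recl big_ord0 addr0 addrA.
  by congr (v 0 _ *: f _ + v 0 _ *: f _ + v 0 _ *: f _); apply: val_inj.
have [j vj] : exists j, v 0 j != 0 by apply/rV0Pn.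
(* a generator with nonzero coefficient in the relation can be dropped *)
have drop w : subseq w [:: f i0; f i1; f i2] -> size w = 2%N ->
    ~ (forall i, in_span w (f i)).
  move=> sw w2 hw; have e : w = [:: f i0; f i1; f i2]; last by rewrite e in w2.
  apply: minf => // a; rewrite (genf a); split; apply: in_span_trans => q.
    by rewrite !inE => /or3P[]/eqP->.
  by move=> /(mem_subseq sw); apply: mem_in_span.
have solve (c0 c1 c2 : F) (f0 f1 f2 : R) : c0 != 0 ->
    c0 *: f0 + c1 *: f1 + c2 *: f2 = 0 -> in_span [:: f1; f2] f0.
  move=> n0 e; apply/in_span2; exists (- (c0^-1 * c1))%:MP, (- (c0^-1 * c2))%:MP.
  transitivity (c0^-1%:MP * (c0%:MP * f0)).
    by rewrite mulrA -mpolyCM mulVf // mul1r.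
  rewrite -!mul_mpolyC -addrA in e.
  by rewrite -[c0%:MP * f0]opprK (addr0_eq e) !mpolyCN !mpolyCM; ring.
have two (f1 f2 : R) : in_span [:: f1; f2] f1 /\ in_span [:: f1; f2] f2.
  by split; apply: mem_in_span; rewrite !inE eqxx ?orbT.
suff : forall k, v 0 k != 0 -> False by move=> /(_ j vj).
apply: I3P.
- move=> h; apply: (drop [:: f i1; f i2]) => //; first exact: subseq_cons.
  by apply: I3P; [exact: solve h rel|exact: (two _ _).1|exact: (two _ _).2].
- move=> h; apply: (drop [:: f i0; f i2]) => //.
    exact: (cat_subseq (subseq_refl [:: f i0]) (subseq_cons [:: f i2] (f i1))).
  apply: I3P; [exact: (two _ _).1| |exact: (two _ _).2].
  apply: (solve (v 0 i1) (v 0 i0) (v 0 i2)) => //.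
  by rewrite [_ *: f i1 + _]addrC.
- move=> h; apply: (drop [:: f i0; f i1]) => //.
    exact: (@prefix_subseq _ [:: f i0; f i1] [:: f i2]).
  apply: I3P; [exact: (two _ _).1|exact: (two _ _).2|].
  apply: (solve (v 0 i2) (v 0 i0) (v 0 i1)) => //.
  by rewrite -addrA addrC.
Qed.

End Minimality.

Section Existence.
Variable F : closedFieldType.
Hypothesis infF : forall s : seq F, exists t, t \notin s.
Local Notation R := {mpoly F[3]}.
Local Notation z := ('X_i2 : R).
Variables (I : idealr R) (f : 'I_3 -> R) (d : nat).
Hypothesis homf : forall i, f i \is d.-homog.
Hypothesis minI : minimally_generates [:: f i0; f i1; f i2] I.
Hypothesis heightI : height I 2.
Hypothesis lciI : locally_complete_intersection I.
Hypothesis cmI : arithmetically_cohen_macaulay I.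

Lemma split_index (j : 'I_3) : exists a c : 'I_3,
  forall u v : 'I_3 -> R, dot u v = u a * v a + u j * v j + u c * v c.
Proof.
move: j; apply: I3P; [exists i1, i2|exists i0, i2|exists i0, i1] => u v;
  rewrite /dot; ring.
Qed.

(** A zero of the combination [s] annihilates the minors of [v] and [s], which
    are those of [v] and [w], so it is a minimal prime of [I] from a finite
    list.  Such a prime does not contain [l], and it does not contain both
    columns; hence it excludes at most one value of [t']. *)
Lemma nowhere_vanishing_syzygy : exists b s,
  [/\ forall i, s i \is b.+1.-homog, dot s f = 0 &
      forall i, exists N, span3 s ('X_i ^+ N)].
Proof.
have genI := minI.1; have homf' i : homogeneous (f i) by exists d.
have hI := homog_generated genI homf'.
have [t [Ps [hpow hPs1 hPs2]]] := ideal_linear_form infF genI homf' heightI.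
have memI := mem_span3 genI.
have nzdI : nzd (fun a => a \in I) (lin t).
  have [g [g0 hg]] := nzd_of_cohen_macaulay hI heightI cmI.
  apply: (nzd_adjoin_power hI.1 hg); apply: origin_radical => //.
    exact: is_ideal_adjoin hI.1.
  by move=> i; have [N [c hc]] := hpow i; exists N, c; apply/memI.
have nzdl : nzd (span3 f) (lin t) by apply: eq_nzd nzdI => a; rewrite memI.
have [b1 [b2 [v [w [b12 bd hv hw fE]]]]] := hilbert_burch_matrix infF homf hpow nzdl.
have prim := primitive_lift homf hpow.
have fj : exists i, f i != 0.
  have [j fj] := elim_z_neq0 hpow; exists j.
  by apply: contraNneq fj => ->; rewrite rmorph0.
have d0 : d != 0%N.
  have [j fj0] := fj; apply: contraNneq fj0 => d0.
  have := homf j; rewrite d0 => /pihomog_dE <-; rewrite pihomog_0.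
  rewrite (ideal_below_origin hI) ?mpolyC0 //.
  by apply/memI/span3_mem.
have [b b2E] : exists b, b2 = b.+1.
  by case: (b2) bd b12 => [|b _ _]; [lia|exists b].
pose s t' i := w i + t'%:MP * lin t ^+ (b2 - b1) * v i.
have notboth P i : minimal_prime_of I P -> ('X_i : R) \notin P ->
    exists j, v j \notin P \/ w j \notin P.
  move=> minP _; apply: (minors_locally_two_generated memI _ (lciI minP)) => a.
  exact: syzygies_of_minors fE fj prim.
have [|t' ht'] := @avoid_finitely_many_primes F infF Ps (fun P t' => (exists i, 'X_i \notin P) /\
    minimal_prime_of I P /\ forall j, s t' j \in P).
  move=> P hP; have [[t1 [[i iP] [minP h1]]]|no] := pselect (exists t1,
    (exists i, ('X_i : R) \notin P) /\ minimal_prime_of I P /\ forall j, s t1 j \in P);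
    last by exists [::] => t1 h; case: no; exists t1.
  exists [:: t1] => t2 [_ [_ h2]]; rewrite inE; apply/eqP; apply: contrapT => /eqP ne.
  have lP := hPs1 P i hP iP.
  have vP j : v j \in P.
    have : (lin t ^+ (b2 - b1)) * v j \in P.
      apply: (@prime_scale _ _ (t2 - t1)); first by rewrite subr_eq0.
      have := rpredB (h2 j) (h1 j); congr (_ \in P).
      by rewrite /s mpolyCD mpolyCN; ring.
    by rewrite prime_idealrM => /orP[/prime_exp|//]; rewrite (negPf lP).
  have wP j : w j \in P.
    by have := rpredB (h1 j) (idealMr (t1%:MP * lin t ^+ (b2 - b1)) (vP j)); rewrite addrK.
  by have [j []] := notboth P i minP iP; rewrite ?vP ?wP.
have hs i : s t' i \is b.+1.-homog.
  rewrite -b2E; apply: rpredD; first exact: hw.2.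
  rewrite -mulrA mul_mpolyC; apply: rpredZ.
  have := dhomogM (dhomogMn (b2 - b1) (lin_homog t)) (hv.2 i).
  by rewrite mul1n subnK.
exists b, (s t'); split=> //.
  transitivity (dot w f + t'%:MP * lin t ^+ (b2 - b1) * dot v f).
    by rewrite /dot /s; ring.
  by rewrite hv.1 hw.1 mulr0 addr0.
have hJ : homog_ideal (span3 (s t')).
  have -> : span3 (s t') = in_span [:: s t' i0; s t' i1; s t' i2].
    by apply/funext => a; apply/propext/span3P.
  apply: homog_ideal_span => u; rewrite !inE => /or3P[]/eqP->; exists b.+1; exact: hs.
move=> i; apply: (homog_radical hJ (X_homog F i)) => Q JQ bQ; apply: contraT => iQ.
have sQ j : s t' j \in Q by apply/JQ/span3_mem.
have IQ : {subset I <= Q}.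
  have hh i' k : v i' * s t' k \in Q by apply/idealMr/sQ.
  have fQ j : f j \in Q.
    rewrite (_ : f j = cross v (s t') j).
      by move: j; apply: I3P; rewrite /cross /= rpredB ?hh.
    by rewrite fE; move: j; apply: I3P; rewrite /cross /s /=; ring.
  by move=> a /memI[c ->]; rewrite /dot !rpredD ?idealMr ?fQ.
have [P hP PQ] := hPs2 Q IQ bQ i iQ.
case: (ht' P hP); split; first by exists i; rewrite PQ.
split; last by move=> j; rewrite PQ.
split=> [a /IQ|Q' IQ' Q'P a aP]; first by rewrite PQ.
apply: contraT => aQ'; case/negP: iQ.
have cP := prime_chainS (height2_chain heightI IQ') (strict_subP Q'P aP aQ').
by rewrite -PQ; apply: (chain3_below cP) => c; rewrite PQ; apply: bQ.
Qed.

(** The operation on the syzygy that makes it regular is compensated by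
    subtracting a multiple of one generator from another one. *)
Lemma regular_syzygy_exists : exists A B C,
  syzygy_on I A B C /\ regular_sequence [:: A; B; C].
Proof.
have [b [s [hs sf hpow]]] := nowhere_vanishing_syzygy.
have memI := mem_span3 minI.1.
(* at the point (0 : 0 : 1) some entry does not vanish *)
have [j sj] : exists j, s j \mPo [tuple 0; 0; z] != 0.
  have [//|s0] := neq0_or_zero (fun i => s i \mPo [tuple 0; 0; z]).
  have [N [c /(congr1 (comp_mpoly [tuple 0; 0; z])) /eqP]] := hpow i2.
  rewrite rmorphXn /dot !rmorphD !rmorphM /= !subst_var !s0 !mulr0 !addr0.
  by rewrite expf_eq0 (negPf (X_neq0 _ _)) andbF.
have [a [c hac]] := split_index j.
have [|t reg] := generic_regular infF (hs a) (hs j) (hs c) _ sj.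
  move=> i; have [N [e he]] := hpow i; exists N; apply/in_span3.
  by exists (e a), (e j), (e c); rewrite he hac.
exists (s j), (s c + t%:MP * s a), (s a); split=> //.
split.
  by split; exists b.+1; rewrite // mul_mpolyC rpredD ?rpredZ.
have hm : f a - t%:MP * f c \is d.-homog by rewrite mul_mpolyC rpredB ?rpredZ.
exists (f j), (f c), (f a - t%:MP * f c).
split; [by exists d|by exists d|by exists d| |]; last first.
  by rewrite -[RHS]sf hac; ring.
apply: (minimally_generates_same_degree (g := triple (f j) (f c) (f a - t%:MP * f c))
  homf _ minI).
  by apply: I3P; [exact: homf|exact: homf|exact: hm].
have fI i : f i \in I by apply/memI/span3_mem.
move=> p; split=> [/memI[e ->]|/in_span3[p1 [p2 [p3 ->]]]]; rewrite /triple /=.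
  apply/in_span3; exists (e j), (e c + e a * t%:MP), (e a); rewrite hac; ring.
by rewrite !rpredD ?idealMr ?rpredB ?idealMr ?fI.
Qed.

End Existence.

Lemma num_infinite (F : numFieldType) (s : seq F) : exists t, t \notin s.
Proof.
pose t : F := 1 + \sum_(u <- s) `|u|; exists t; apply/negP => ts.
have t0 : 0 <= \sum_(u <- s) `|u| by apply: Num.Theory.sumr_ge0.
have : `|t| <= \sum_(u <- s) `|u|.
  by rewrite (big_rem t) //= Num.Theory.lerDl Num.Theory.sumr_ge0.
rewrite Num.Theory.ger0_norm ?Num.Theory.addr_ge0 // /t.
by rewrite Num.Theory.gerDr Num.Theory.ler10.
Qed.

End HilbertBurch.

Import HilbertBurch.

Theorem theorem2p1 (K : realType) (I : idealr {mpoly (complex K)[3]})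
  (hI : height I 2)
  (hlci : locally_complete_intersection I)
  (hgen : exists (d : nat) (f1 f2 f3 : {mpoly (complex K)[3]}),
      [/\ f1 \is d.-homog, f2 \is d.-homog, f3 \is d.-homog
        & minimally_generates [:: f1; f2; f3] I]) :
  arithmetically_cohen_macaulay I <->
  exists A B C : {mpoly (complex K)[3]},
    syzygy_on I A B C /\ regular_sequence [:: A; B; C].
Proof.
have infC := @num_infinite (complex K).
split.
  have [d [f1 [f2 [f3 [h1 h2 h3 hmin]]]]] := hgen.
  apply: (@regular_syzygy_exists _ infC I (triple f1 f2 f3) d) => //.
  exact: I3P.
move=> [A [B [C [[_ [f1 [f2 [f3 [h1 h2 h3 [hg _] syz]]]]] reg]]]].
apply: (@cohen_macaulay_of_regular_syzygy _ infC I (triple f1 f2 f3) _ _ hI _ _ _ reg) => //.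
exact: I3P.
Qed.
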